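(* Let $N\ge 1$ and $J=(0,1)$. For every $\varepsilon\in J$, let $\rho_\varepsilon\colon \mathbb{R}^N\to[0,+\infty)$ be measurable, and let $$\mathscr{F}_\varepsilon[u]=\frac12\int_{\mathbb{R}^N\times\mathbb{R}^N}\rho_\varepsilon(y-x)\frac{|u(y)-u(x)|^2}{|y-x|^2}\,\mathrm{d}y\,\mathrm{d}x .$$ Suppose that there exists $M\ge0$ such that for every $R>0$ $$\limsup_{\varepsilon\to0}\left[\int_{B(0,R)}\rho_{\varepsilon}(z)\,\mathrm{d}z+R^2\int_{B(0,R)^c}\frac{\rho_{\varepsilon}(z)}{|z|^2}\,\mathrm{d}z\right]\le M.$$ Suppose also that the family $\{\nu_\varepsilon\}_{\varepsilon\in J}$ of Radon measures on $\mathbb{R}^N$ defined by $$\langle\nu_\varepsilon,f\rangle=\int_{\mathbb{R}^N}\rho_{\varepsilon}(z)f(z)\,\mathrm{d}z\qquad\text{for all }f\in C_c(\mathbb{R}^N)$$ converges, as $\varepsilon\to0$, locally weakly-$\ast$ in the sense of Radon measures to $\alpha\delta_0$, where $\alpha\ge0$ is a constant and $\delta_0$ is the Dirac delta at $0$. Then there exist a sequence $\{\varepsilon_k\}\subset J$ with $\varepsilon_k\to0$ and a finite positive Radon measure $\mu$ on $\mathbb{S}^{N-1}$ such that for every $u\in H^1(\mathbb{R}^N)$ $$\lim_{k\to+\infty}\mathscr{F}_{\varepsilon_k}[u]=\frac12\int_{\mathbb{R}^N}\int_{\mathbb{S}^{N-1}}|\nabla u(x)\cdot\sigma|^2\,\mathrm{d}\mu(\sigma)\,\mathrm{d}x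 .$$
   Context: Functions $u$ are real-valued. $B(0,R)$ is the open ball in $\mathbb{R}^N$ of center $0$ and radius $R$, and $B(0,R)^c$ is its complement. $\mathbb{S}^{N-1}$ is the unit sphere of $\mathbb{R}^N$. $H^1(\mathbb{R}^N)$ is the space of $u\in L^2(\mathbb{R}^N)$ whose distributional gradient is in $L^2(\mathbb{R}^N)$. The functionals $\mathscr{F}_\varepsilon$ take values in $[0,+\infty]$. Local weak-$\ast$ convergence $\nu_\varepsilon\to\nu$ of Radon measures on $\mathbb{R}^N$ means $\int f\,\mathrm{d}\nu_\varepsilon\to\int f\,\mathrm{d}\nu$ for every $f\in C_c(\mathbb{R}^N)$. The measures $\nu_\varepsilon$ are considered for $\varepsilon$ small enough, where the limsup bound ensures $\rho_\varepsilon\in L^1_{\rm loc}(\mathbb{R}^N)$. *)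

(* Defs.v *)
From HB Require Import structures.
From mathcomp Require Import all_boot all_order all_algebra.
From mathcomp Require Import all_classical all_reals all_analysis.
From mathcomp Require Import measurable_realfun.

Set Implicit Arguments.
Unset Strict Implicit.
Unset Printing Implicit Defensive.

Import Order.TTheory GRing.Theory Num.Theory.
Import numFieldNormedType.Exports.

Local Open Scope classical_set_scope.
Local Open Scope ring_scope.

HB.instance Definition _ (R : realType) (m n : nat) :=
  @isMeasurable.Build default_measure_display 'M[R]_(m, n)
    <<s @open 'M[R]_(m, n) >> (@sigma_algebra0 _ setT _)
    (@sigma_algebraC _ _) (@sigma_algebra_bigcup _ setT _).

Section borel_rV.
Context {R : realType}.

Lemma open_measurable_rV n (U : set 'rV[R]_n) : open U -> measurable U.
Proof. exact: sub_sigma_algebra. Qed.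

Lemma measurable_coord n (i : 'I_n) :
  measurable_fun setT (fun x : 'rV[R]_n => x 0 i : measurableTypeR R).
Proof.
apply: (measurability _ (RGenOInfty.measurableE R)) => // _ [_ [a ->] <-].
rewrite setTI; apply: open_measurable_rV.
by apply: open_comp => // x _; exact: coord_continuous.
Qed.

Lemma open_rV_bigcup n (U : set 'rV[R]_n) : open U ->
  U = \bigcup_(qk in [set qk : 'rV[rat]_n * nat |
        ball (map_mx ratr qk.1 : 'rV[R]_n) qk.2.+1%:R^-1 `<=` U])
      ball (map_mx ratr qk.1 : 'rV[R]_n) qk.2.+1%:R^-1.
Proof.
move=> oU; apply/seteqP; split => [x Ux|x [qk /= + xq]]; last exact.
have /nbhs_ballP[e /= e0 eU] := open_nbhs_nbhs (conj oU Ux).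
have [k ke] : exists k, k.+1%:R^-1 + k.+1%:R^-1 < e.
  have e20 : 0 < e / 2 by rewrite divr_gt0.
  have [k _ /(_ k (leqnn _)) ke] := near_infty_natSinv_lt (PosNum e20).
  by exists k; rewrite [ltRHS]splitr ltrD.
have k0 : 0 < k.+1%:R^-1 :> R by rewrite invr_gt0.
have /choice[q qx] : forall i : 'I_n, exists q : rat,
    ball (ratr q : R) k.+1%:R^-1 (x 0 i).
  move=> i; have [|q] := @rat_in_itvoo R (x 0 i) (x 0 i + k.+1%:R^-1).
    by rewrite ltrDl.
  rewrite in_itv/= => /andP[xq qxk]; exists q.
  by rewrite /ball/= gtr0_norm ?subr_gt0// ltrBlDl.
have qx' : ball (map_mx ratr (\row_i q i) : 'rV[R]_n) k.+1%:R^-1 x.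
  by split=> // i j; rewrite !mxE ord1.
exists (\row_i q i, k) => //= y qy; apply: eU.
by apply: le_ball (ltW ke) _ _; apply: ball_triangle qy; exact: ball_sym.
Qed.

Lemma measurable_fun_rV d (T : measurableType d) n (f : T -> 'rV[R]_n) :
  (forall i, measurable_fun setT (fun t => f t 0 i : measurableTypeR R)) ->
  measurable_fun setT f.
Proof.
move=> mf; apply: (@measurability _ _ _ _ _ _ (@open 'rV[R]_n)) => //.
move=> _ [U oU <-]; rewrite setTI (open_rV_bigcup oU) preimage_bigcup.
rewrite bigcup_mkcond; apply: countable_bigcupT_measurable => // -[q k].
case: ifPn => // _ /=; set e := _^-1.
rewrite (_ : _ @^-1` _ =
    \bigcap_i ((fun t => f t 0 i) @^-1` ball (ratr (q 0 i) : R) e)).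
  apply: fin_bigcap_measurable; first exact: finite_finset.
  move=> i _; rewrite -[X in measurable X]setTI; apply: mf => //.
  by apply: open_measurable; exact: ball_open.
apply/seteqP; split=> [t [_ qt] i _|t qt] /=.
  by have := qt 0 i; rewrite mxE.
by split=> [|i j]; [rewrite invr_gt0|rewrite mxE ord1; exact: qt].
Qed.

End borel_rV.

Section lebesgue_rV.
Context {R : realType}.

Definition cons_rV n (p : measurableTypeR R * 'rV[R]_n) : 'rV[R]_n.+1 :=
  row_mx (p.1%:M : 'M[R]_1) p.2.

Definition uncons_rV n (x : 'rV[R]_n.+1) : measurableTypeR R * 'rV[R]_n :=
  (x 0 0, rsubmx (x : 'M[R]_(1, 1 + n))).

Lemma cons_rVK n : cancel (@cons_rV n) (@uncons_rV n).
Proof.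
move=> [a x]; rewrite /uncons_rV /cons_rV/= row_mxKr; congr pair.
transitivity (row_mx (a%:M : 'M[R]_1) x 0 (lshift n 0)).
  by congr (row_mx _ _ _ _); exact/val_inj.
by rewrite row_mxEl mxE eqxx mulr1n.
Qed.

Lemma uncons_rVK n : cancel (@uncons_rV n) (@cons_rV n).
Proof.
move=> x; rewrite /uncons_rV /cons_rV/=.
apply: etrans (hsubmxK (x : 'M[R]_(1, 1 + n))).
congr (row_mx _ _); apply/rowP => i; rewrite !mxE !ord1 eqxx mulr1n.
by congr (x 0 _); exact/val_inj.
Qed.

Lemma cons_rV0 n (p : measurableTypeR R * 'rV[R]_n) : cons_rV p 0 0 = p.1.
Proof. by rewrite -[in RHS](cons_rVK p). Qed.

Lemma cons_rVS n (p : measurableTypeR R * 'rV[R]_n) i :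
  cons_rV p 0 (lift ord0 i) = p.2 0 i.
Proof.
transitivity ((uncons_rV (cons_rV p)).2 0 i); last by rewrite cons_rVK.
by rewrite [RHS]mxE; congr (cons_rV p 0 _); exact/val_inj.
Qed.

Lemma measurable_cons_rV n : measurable_fun setT (@cons_rV n).
Proof.
apply: measurable_fun_rV => i; have [j ->|->] := unliftP ord0 i.
  under eq_fun do rewrite cons_rVS.
  exact: (measurableT_comp (measurable_coord j) measurable_snd).
under eq_fun do rewrite cons_rV0.
exact: measurable_fst.
Qed.

Lemma measurable_uncons_rV n : measurable_fun setT (@uncons_rV n).
Proof.
apply: measurable_fun_pair; first exact: measurable_coord.
apply: measurable_fun_rV => i.
by under eq_fun do rewrite mxE; exact: measurable_coord.
Qed.

Section lebesgue_rVS.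
Variables (n : nat) (m : {sigma_finite_measure set 'rV[R]_n -> \bar R}).

Definition lebesgue_rVS : set 'rV[R]_n.+1 -> \bar R :=
  pushforward (lebesgue_measure \x m)%E (@cons_rV n).

Let mcons := @measurable_cons_rV n.

Let lebesgue_rVS0 : lebesgue_rVS set0 = 0%E.
Proof. exact: measure0. Qed.

Let lebesgue_rVS_ge0 A : (0 <= lebesgue_rVS A)%E.
Proof. exact: measure_ge0. Qed.

Let lebesgue_rVS_sigma_additive : semi_sigma_additive lebesgue_rVS.
Proof. exact: measure_semi_sigma_additive. Qed.

HB.instance Definition _ := isMeasure.Build _ _ _ lebesgue_rVS
  lebesgue_rVS0 lebesgue_rVS_ge0 lebesgue_rVS_sigma_additive.

Lemma lebesgue_rVS_sigma_finite : sigma_finite setT lebesgue_rVS.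
Proof.
have /sigma_finiteP[F [FT ndF Foo]] := sigma_finiteT (@lebesgue_measure R).
have /sigma_finiteP[G [GT ndG Goo]] := sigma_finiteT m.
exists (fun k => @uncons_rV n @^-1` (F k `*` G k)).
  rewrite -preimage_bigcup -(preimage_setT (@uncons_rV n)).
  congr preimage; rewrite -setXTT FT GT; apply/seteqP; split=> [[x y]|].
    move=> /= [[i _ Fix] [j _ Gjy]]; exists (maxn i j) => //; split.
      exact: (subsetPset _ _ (ndF _ _ (leq_maxl i j))).
    exact: (subsetPset _ _ (ndG _ _ (leq_maxr i j))).
  by move=> [x y] [i _ [Fx Gy]]; split; exists i.
move=> k; have [mFk Fk] := Foo k; have [mGk Gk] := Goo k; split.
  rewrite -[X in measurable X]setTI; apply: measurable_uncons_rV => //.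
  exact: measurableX.
rewrite /lebesgue_rVS /pushforward -comp_preimage.
rewrite (_ : _ \o _ = id); last by apply/funext; exact: cons_rVK.
by rewrite /= product_measure1E// lte_mul_pinfty// ge0_fin_numE.
Qed.

HB.instance Definition _ :=
  @Measure_isSigmaFinite.Build _ _ _ lebesgue_rVS lebesgue_rVS_sigma_finite.

End lebesgue_rVS.

(* Lebesgue measure on the Borel sets of R^n, as an iterated product: the map
   cons_rV identifies R * R^n with R^(n+1), and R^0 carries the Dirac mass of
   its only point. *)
Fixpoint lebesgue_rV n : {sigma_finite_measure set 'rV[R]_n -> \bar R} :=
  if n is n'.+1 then lebesgue_rVS (lebesgue_rV n') else \d_(0 : 'rV[R]_0).

(* This value on boxes characterizes Lebesgue measure. *)
Lemma lebesgue_rV_box n (a b : 'rV[R]_n) : (forall i, a 0 i <= b 0 i) ->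
  lebesgue_rV n [set x | forall i, x 0 i \in `]a 0 i, b 0 i]] =
  (\prod_(i < n) (b 0 i - a 0 i))%:E.
Proof.
elim: n a b => [|n IHn] a b ab.
  by rewrite /= diracE big_ord0 mem_set// => -[].
set c := fun x : 'rV[R]_n.+1 => (uncons_rV x).2.
have cE (x : 'rV[R]_n.+1) i : c x 0 i = x 0 (lift ord0 i).
  by rewrite mxE; congr (x 0 _); exact/val_inj.
have mbox : measurable
    [set x : 'rV[R]_n | forall i, x 0 i \in `](c a) 0 i, (c b) 0 i]].
  rewrite (_ : [set _ | _] = \bigcap_i
      ((fun x : 'rV[R]_n => x 0 i) @^-1` `](c a) 0 i, (c b) 0 i]%classic)).
    apply: fin_bigcap_measurable; first exact: finite_finset.
    by move=> i _; rewrite -[X in measurable X]setTI; exact: measurable_coord.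
  by apply/seteqP; split=> [x abx i _|x abx i]; [exact: abx|exact: (abx i)].
rewrite big_ord_recl EFinM /= /lebesgue_rVS /pushforward.
rewrite (_ : _ @^-1` _ = `]a 0 0, b 0 0]%classic `*`
    [set x : 'rV[R]_n | forall i, x 0 i \in `](c a) 0 i, (c b) 0 i]]); last first.
  apply/seteqP; split => [p abp|p [p1 p2] i] /=.
    split => [|i]; first by have := abp ord0; rewrite cons_rV0.
    by have := abp (lift ord0 i); rewrite cons_rVS !cE.
  have [j ->|->] := unliftP ord0 i; last by rewrite cons_rV0.
  by have := p2 j; rewrite cons_rVS !cE.
rewrite product_measure1E// IHn; last by move=> i; rewrite !cE.
congr (_ * _)%E; last by congr EFin; apply: eq_bigr => i _; rewrite !cE.
rewrite -[LHS]/(lebesgue_measure `]a 0 0, b 0 0]%classic).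
rewrite lebesgue_measure_itv/= lte_fin; case: ltgtP (ab ord0) => // -> _.
by rewrite subrr.
Qed.

End lebesgue_rV.

Section euclidean.
Context {R : realType} {n : nat}.
Implicit Types x y : 'rV[R]_n.

Definition dot x y : R := \sum_(i < n) x 0 i * y 0 i.

(* The library norm `|x| on 'rV[R]_n is the sup norm; it induces the same
   topology. *)
Definition enorm x : R := Num.sqrt (dot x x).

Definition eball (r : R) : set 'rV[R]_n := [set x | enorm x < r].

Definition unit_sphere : set 'rV[R]_n := [set x | enorm x = 1].

End euclidean.
Arguments unit_sphere {R} n.

Section function_spaces.
Context {R : realType} {n : nat}.
Implicit Types f u : 'rV[R]_n -> R.
Local Notation leb := (@lebesgue_rV R n).

(* Measurability for the completion of the Borel sigma-algebra with respect to
   Lebesgue measure. The library integral of a nonnegative function is the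
   supremum of the integrals of the Borel simple functions below it; it agrees
   with the Lebesgue integral on all Lebesgue-measurable functions, Borel or
   not. *)
Definition lebesgue_measurable f :=
  forall B : set R, measurable B -> completed_algebra_gen leb (f @^-1` B).

Definition compactly_supported f := compact (closure [set x | f x != 0]).

Definition Cc f := continuous f /\ compactly_supported f.

Definition partial (i : 'I_n) f : 'rV[R]_n -> R :=
  fun x => 'D_(delta_mx 0 i) f x.

Definition iter_partial (s : seq 'I_n) f := foldr partial f s.

Definition smooth f := forall s : seq 'I_n,
  continuous (iter_partial s f) /\
  forall i x, derivable (iter_partial s f) x (delta_mx 0 i).

Definition test_function f := smooth f /\ compactly_supported f.

Definition L1loc f := lebesgue_measurable f /\
  forall K : set 'rV[R]_n, compact K -> (\int[leb]_(x in K) `|f x|%:E < +oo)%E.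

Definition L2 f := lebesgue_measurable f /\ finite_norm leb 2%:E f.

(* the distributional gradient of u is the locally integrable field g *)
Definition weak_gradient u (g : 'rV[R]_n -> 'rV[R]_n) :=
  [/\ L1loc u, forall i, L1loc (fun x => g x 0 i) &
    forall phi, test_function phi -> forall i,
      (\int[leb]_x (u x * partial i phi x)%:E =
       - \int[leb]_x (g x 0 i * phi x)%:E)%E].

(* H^1(R^n) at the level of functions rather than a.e. classes. *)
Definition H1 u := L2 u /\
  exists2 g, weak_gradient u g & forall i, L2 (fun x => g x 0 i).

(* In the integral, p = (x, y). The integrand is 0 on the null set y = x, since
   0^-1 = 0. *)
Definition nonlocal_energy (rho : 'rV[R]_n -> R) u : \bar R :=
  (2^-1)%:E * \int[(leb \x leb)%E]_p
    (rho (p.2 - p.1) * (`|u p.2 - u p.1| ^+ 2 / enorm (p.2 - p.1) ^+ 2))%:E.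

End function_spaces.

(* Main.v *)
(* After the change of variables y = x + z, the energy is half the integral of
   rho_e(z) D(z) / |z|^2, where D(z) is the squared L2 norm of u(. + z) - u. The
   kernels concentrate at 0, and the bounds D(z) <= 4 |u|^2 far from 0 and
   D(z) = \int |grad u . z|^2 + o(|z|^2) near 0 show that, up to o(1), the energy
   is half of sum_ij a_ij m_ij(e), where a_ij = \int d_i u d_j u and m_ij(e) is
   the integral of rho_e z_i z_j / |z|^2 over the unit ball. The matrices m(e) are
   bounded and positive semidefinite: along a sequence they converge to a matrix
   of the form sum_v v v^T, and mu is the sum of the Dirac masses at v / |v|
   weighted by |v|^2.

   The expansion of D is proved by duality with test functions, which only needs
   that translations are continuous in L2. The density of test functions comes
   from a monotone class argument, starting with products of the functions
   exp(-1/x). *)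
Require Import Defs.
From HB Require Import structures.
From mathcomp Require Import all_boot all_order all_algebra.
From mathcomp Require Import all_classical all_reals all_analysis.
From mathcomp Require Import measurable_realfun.
From mathcomp Require Import ring lra.

Set Implicit Arguments.
Unset Strict Implicit.
Unset Printing Implicit Defensive.

Import Order.TTheory GRing.Theory Num.Theory.
Import numFieldNormedType.Exports.
Import HBNNSimple.

Local Open Scope classical_set_scope.
Local Open Scope ring_scope.

(** * Null sets and Borel representatives *)

(** The sequence must be chosen before [u]. This is possible because [u] enters the limit only
    through the numbers a_ij, which are paired with finitely many moments m_ij: one extraction in a
    finite-dimensional space serves every [u], without compactness of measures on the sphere. The
    limit sees [mu] only through its second moments, which is why finitely many Dirac masses are
    enough.

    The weak convergence is tested on cutoffs that vanish at 0, whose integral against alpha delta_0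
    is 0. The mass of every annulus around 0 thus tends to 0, and the radius below which the
    expansion of D is used and the one beyond which D is bounded crudely can be fixed separately,
    depending on [u].

    The kernels, [u] and its gradient are only Lebesgue measurable, while the measure lives on Borel
    sets and Tonelli and dominated convergence ask for Borel functions; all are replaced by Borel
    functions equal to them off a Borel null set. Moreover [Du] is an arbitrary weak gradient, only
    locally integrable, so its square integrability is recovered from the uniqueness of weak
    gradients almost everywhere. *)

Section off_null.
Local Open Scope ereal_scope.
Context d (T : measurableType d) (R : realType).
Variables (mu : {measure set T -> \bar R}) (N : set T).
Hypotheses (mN : measurable N) (N0 : mu N = 0).
Implicit Types f g : T -> \bar R.

Let le_integral_off_null f g : (forall x, 0 <= f x) -> (forall x, 0 <= g x) ->
  (forall x, ~ N x -> f x <= g x) -> \int[mu]_x f x <= \int[mu]_x g x.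
Proof.
move=> f0 g0 fg; rewrite !ge0_integralTE//; apply: ge_ereal_sup => _ [h /= hf <-].
have mC : measurable (~` N) by exact: measurableC.
apply: ereal_sup_ubound; exists (proj_nnsfun h mC) => [x /=|].
  rewrite mindicE; have [xN|xN] := boolP (x \in N).
    by rewrite memNset ?mulr0// => /=; apply; rewrite inE in xN.
  rewrite mem_set ?mulr1; last by move=> /=; rewrite notin_setE in xN.
  by rewrite (le_trans (hf x))// fg//; rewrite notin_setE in xN.
rewrite -!integralT_nnsfun; apply: ae_eq_integral => //.
- by apply/measurable_EFinP; exact: measurable_funPT.
- by apply/measurable_EFinP; exact: measurable_funPT.
- exists N; split => // x /= /not_implyP[_] hx; apply: contrapT => Nx; apply: hx.
  by rewrite mindicE mem_set// mulr1.
Qed.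

(* No measurability of f and g is needed: the library integral of a nonnegative
   function is a supremum over simple functions, and multiplying these by the
   indicator of the complement of N does not change their integral. *)
Lemma eq_integral_off_null (D : set T) f g : (forall x, ~ N x -> f x = g x) ->
  \int[mu]_(x in D) f x = \int[mu]_(x in D) g x.
Proof.
move=> fg; rewrite integral_mkcond [RHS]integral_mkcond.
have {}fg x : ~ N x -> (f \_ D) x = (g \_ D) x.
  by move=> Nx; rewrite /patch fg.
rewrite integralE [RHS]integralE; congr (_ - _);
  apply/eqP; rewrite eq_le !le_integral_off_null// => x Nx;
  by rewrite ?(funeposE, funenegE) fg.
Qed.
End off_null.

(** The superlevel sets at rational thresholds determine [f], and there are countably many of them.
    Each is a Borel set plus a negligible one, so a single Borel null set [Z] absorbs all the
    exceptions. *)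
Lemma lebesgue_measurable_borel (R : realType) n (f : 'rV[R]_n -> R) :
  lebesgue_measurable f ->
  exists Z : set 'rV[R]_n, [/\ measurable Z, lebesgue_rV n Z = 0%E &
    measurable_fun setT (f \_ (~` Z))].
Proof.
move=> mf.
have /choice[A HA] (q : rat) : exists A : set 'rV[R]_n, measurable A /\
    exists N, (lebesgue_rV n).-negligible N /\ A `|` N = f @^-1` `]ratr q,
      +oo[%classic.
  have [//|A mA [N negN AN]] := mf `]ratr q, +oo[%classic.
  by exists A; split => //; exists N.
have mA q : measurable (A q) by have [] := HA q.
have /choice[N HN] q := (HA q).2.
pose F k := if unpickle k is Some q then N q else set0.
have FE q : F (pickle q) = N q by rewrite /F pickleK.
have [Z [mZ Z0 FZ]] : (lebesgue_rV n).-negligible (\bigcup_k F k).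
  apply: negligible_bigcup => k; rewrite /F; case: unpickle => [q|].
    exact: (HN q).1.
  exact: negligible_set0.
clearbody F.
exists Z; split => //.
suff mfZ : measurable_fun (~` Z) (f : _ -> measurableTypeR R).
  exact: (measurable_restrictT f (measurableC mZ)).1 mfZ.
apply: (measurability _ (RGenOInfty.measurableE R)) => // _ [_ [a ->] <-].
rewrite (_ : _ `&` _ =
    \bigcup_(q in [set q : rat | a < ratr q]) (A q `&` ~` Z)); last first.
  apply/seteqP; split => x /=; rewrite !in_itv/= !andbT.
    move=> [Zx fx]; have [q] := rat_in_itvoo fx; rewrite in_itv/= => /andP[aq qf].
    exists q => //; split => //.
    have : (f @^-1` `]ratr q, +oo[%classic) x by rewrite /= in_itv/= andbT.
    rewrite -(HN q).2 => -[//|Nx]; exfalso; apply: Zx; apply: FZ.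
    by exists (pickle q); [exact: I|rewrite FE].
  move=> [q /= aq [Aq Zx]]; split => //.
  have : (A q `|` N q) x by left.
  by rewrite (HN q).2 /= in_itv/= andbT; exact: lt_trans.
by rewrite bigcup_mkcond; apply: countable_bigcupT_measurable => // q; case:
  ifPn => // _; apply: measurableI => //; exact: measurableC.
Qed.

(** * Translation invariance *)

Section lebesgue_rV_integral.
Context {R : realType}.
Local Open Scope ereal_scope.

Lemma cons_rVD n (p : measurableTypeR R * 'rV[R]_n) (z : 'rV[R]_n.+1) :
  (cons_rV p + z)%R = cons_rV ((p.1 + z 0 0)%R, (p.2 + (uncons_rV z).2)%R).
Proof.
apply/rowP => i; rewrite mxE; have [j ->|->] := unliftP ord0 i.
  by rewrite !cons_rVS/= !mxE; congr (_ + z 0 _)%R; exact/val_inj.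
by rewrite !cons_rV0.
Qed.

Lemma lebesgue_measure_shift (a : R) (A : set R) :
  measurable A -> lebesgue_measure ((fun x => (x + a)%R) @^-1` A) =
    lebesgue_measure A.
Proof.
have ma : measurable_fun setT (fun x : measurableTypeR R => (x + a)%R :
    measurableTypeR R).
  exact: measurable_funD.
move=> mA; apply/esym.
rewrite (@lebesgue_measure_unique R (pushforward lebesgue_measure (fun x :
  measurableTypeR R => (x + a)%R : measurableTypeR R)))//.
move=> _ [[b c] _ <-]; rewrite /= /pushforward.
rewrite (_ : _ @^-1` _ = `](b - a)%R, (c - a)%R]%classic); last first.
  by apply/seteqP; split => x /=; rewrite !in_itv/= ltrBlDr lerBrDr.
rewrite -/(lebesgue_measure _) !lebesgue_measure_itv/= !lte_fin ltrD2r.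
case: ifP => // _.
by rewrite -!EFinB; congr EFin; ring.
Qed.
Lemma ge0_integral_lebesgue_shift (a : R) (f : measurableTypeR R -> \bar R) :
  measurable_fun setT f -> (forall x, 0 <= f x) ->
  \int[lebesgue_measure]_x f (x + a)%R = \int[lebesgue_measure]_x f x.
Proof.
move=> mf f0.
have ma : measurable_fun setT (fun x : measurableTypeR R => (x + a)%R :
    measurableTypeR R).
  exact: measurable_funD.
have := @ge0_integral_pushforward _ _ _ _ R _ ma lebesgue_measure setT f
    measurableT mf (fun x _ => f0 x).
rewrite preimage_setT => <-.
apply: eq_measure_integral => A mA _.
exact: lebesgue_measure_shift.
Qed.
End lebesgue_rV_integral.

Section lebesgue_rV_shift.
Context {R : realType}.
Local Open Scope ereal_scope.
Implicit Types n : nat.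

Lemma ge0_integral_rVS n (f : 'rV[R]_n.+1 -> \bar R) :
  measurable_fun setT f -> (forall x, 0 <= f x) ->
  \int[lebesgue_rV n.+1]_x f x =
  \int[lebesgue_measure]_a \int[lebesgue_rV n]_x f (cons_rV (a, x)).
Proof.
move=> mf f0; rewrite [LHS]ge0_integral_pushforward//=; last exact:
  measurable_cons_rV.
rewrite preimage_setT fubini_tonelli1//=.
  exact: measurableT_comp mf (@measurable_cons_rV R n).
Qed.

Lemma measurable_shift n (z : 'rV[R]_n) : measurable_fun setT (fun x :
    'rV[R]_n => (x + z)%R).
Proof.
apply: measurable_fun_rV => i; under eq_fun do rewrite mxE.
by apply: measurable_funD => //; exact: measurable_coord.
Qed.

(** By induction on the dimension: Tonelli separates the first coordinate, shifted in one dimension,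
    from the others, shifted by the induction hypothesis. *)
Lemma ge0_integral_shift n (z : 'rV[R]_n) (f : 'rV[R]_n -> \bar R) :
  measurable_fun setT f -> (forall x, 0 <= f x) ->
  \int[lebesgue_rV n]_x f (x + z)%R = \int[lebesgue_rV n]_x f x.
Proof.
elim: n z f => [|n IHn] z f mf f0.
  by apply: eq_integral => x _; congr f; apply/rowP => -[].
have mfz := measurableT_comp mf (measurable_shift z).
rewrite (ge0_integral_rVS mf f0) (ge0_integral_rVS mfz (fun x => f0 _)).
have mfc : measurable_fun setT (fun p => f (cons_rV p)).
  exact: measurableT_comp mf (@measurable_cons_rV R n).
transitivity (\int[lebesgue_measure]_a
    \int[lebesgue_rV n]_x f (cons_rV ((a + z ord0 ord0)%R, x))).
  apply: eq_integral => a _.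
  rewrite -(IHn (uncons_rV z).2 (fun x => f (cons_rV ((a + z ord0 ord0)%R, x)))).
  - by apply: eq_integral => x _; rewrite /= cons_rVD.
  - exact: measurableT_comp mfc (pair1_measurable _).
  - by move=> x; exact: f0.
apply: (ge0_integral_lebesgue_shift (z ord0 ord0)
  (f := fun a => \int[lebesgue_rV n]_x f (cons_rV (a, x)))).
  by apply: (measurable_fun_fubini_tonelli_F _ mfc) => p; exact: f0.
by move=> x; exact: integral_ge0.
Qed.

Lemma integral_shift n (z : 'rV[R]_n) (f : 'rV[R]_n -> \bar R) :
  measurable_fun setT f ->
  \int[lebesgue_rV n]_x f (x + z)%R = \int[lebesgue_rV n]_x f x.
Proof.
move=> mf; rewrite integralE [RHS]integralE; congr (_ - _).
  rewrite -(ge0_integral_shift z (measurable_funepos mf))//.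
  by apply: eq_integral => x _; rewrite !funeposE.
rewrite -(ge0_integral_shift z (measurable_funeneg mf))//.
by apply: eq_integral => x _; rewrite !funenegE.
Qed.

End lebesgue_rV_shift.

(** * Bump functions *)

Section hexp.
Context {R : realType}.
Implicit Types p : {poly R}.

(* The derivative of p(1/x) exp(-1/x) is q(1/x) exp(-1/x) with
   q = (p - p') X^2, so this family is closed under differentiation. *)
Definition hexp p (x : R) : R := if 0 < x then p.[x^-1] * expR (- x^-1) else 0.

(** In p X + c the extra factor y is absorbed by half of the exponential, y exp(- l y / 2) <= 2 / l,
    and the induction hypothesis is used at l / 2; hence the quantification over all l > 0. *)
Lemma poly_expR_bounded p (l : R) : 0 < l ->
  exists C, forall y, 0 <= y -> `|p.[y]| * expR (- (l * y)) <= C.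
Proof.
elim/poly_ind: p l => [|p c IH] l l0.
  by exists 0 => y y0; rewrite horner0 normr0 mul0r.
have l20 : 0 < l / 2 by rewrite divr_gt0.
have [C HC] := IH _ l20; exists ((l / 2)^-1 * C + `|c|) => y y0.
rewrite hornerMXaddC.
have e1 : expR (- (l * y)) <= 1.
  by rewrite -expR0 ler_expR oppr_le0 mulr_ge0// ltW.
rewrite (le_trans (ler_wpM2r (expR_ge0 _) (ler_normD _ _)))// mulrDl lerD//;
  last first.
  by rewrite ler_piMr.
rewrite normrM (ger0_norm y0).
have -> : - (l * y) = - (l / 2 * y) - (l / 2 * y) by field.
rewrite expRD mulrACA mulrC ler_pM ?mulr_ge0 ?expR_ge0//; last exact: HC.
rewrite expRN ler_pdivrMr ?expR_gt0// ler_pdivlMl//.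
by apply: le_trans (expR_ge1Dx _); rewrite lerDr.
Qed.

Lemma hexp_bounded p : exists C, forall x, `|hexp p x| <= C.
Proof.
have [C HC] := poly_expR_bounded p ltr01.
exists C => x; rewrite /hexp; case: ifPn => x0; last first.
  rewrite normr0; apply: le_trans (HC 0 (lexx _)).
  by rewrite mulr_ge0 ?expR_ge0.
rewrite normrM (ger0_norm (expR_ge0 _)); have := HC x^-1.
by rewrite mul1r; apply; rewrite invr_ge0 ltW.
Qed.

Lemma hexp_le1 x : hexp 1 x <= 1.
Proof.
rewrite /hexp; case: ifPn => // x0.
by rewrite hornerC mul1r -expR0 ler_expR oppr_le0 invr_ge0 ltW.
Qed.

Lemma hexp_ge0 x : 0 <= hexp 1 x.
Proof. by rewrite /hexp; case: ifPn => // x0; rewrite hornerC mul1r expR_ge0. Qed.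

Lemma is_derive_hexp p (x : R) :
  is_derive x 1 (hexp p) (hexp ((p - p^`()) * 'X^2) x).
Proof.
have [x0|x0|->] := ltgtP x 0.
- rewrite {2}/hexp ltNge (ltW x0)/=.
  apply: (@near_eq_is_derive _ _ _ (cst 0)).
    near=> y; rewrite /hexp ltNge ifN// negbK ltW//.
    by near: y; exact: lt_nbhsl.
- rewrite {2}/hexp x0.
  have xu : x != 0 by rewrite gt_eqF.
  have dV : is_derive x 1 (fun y : R => y^-1) (- x ^- 2).
    by apply: is_derive_eq (is_deriveV xu (is_derive_id x 1)) _; rewrite [_ *:
      _]mulr1.
  have dp := is_derive1_comp (is_derive_poly p x^-1) dV.
  have de : is_derive x 1 (fun y : R => expR (- y^-1)) (expR (- x^-1) * (- - x
      ^- 2)).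
    exact: (@is_derive1_comp R expR (fun y => - y^-1) x _ _ (is_derive_expR _)
      (is_deriveN dV)).
  have dpe : is_derive x 1 (fun y => p.[y^-1] * expR (- y^-1))
      (((p - p^`()) * 'X^2).[x^-1] * expR (- x^-1)).
    apply: is_derive_eq (is_deriveM dp de) _.
    by rewrite /= !hornerE/= /GRing.scale/=; field.
  apply: near_eq_is_derive dpe.
  near=> y; rewrite /hexp ifT//.
  by near: y; exact: lt_nbhsr.
(* At 0, for h > 0, the difference quotient is h times (p X^2)(1/h) exp(-1/h), a bounded factor, so
   it tends to 0; for h < 0 it is 0. *)
- have [C HC] := poly_expR_bounded (p * 'X^2) ltr01.
  have h0 q : hexp q 0 = 0 by rewrite /hexp ltxx.
  rewrite h0.
  suff cv : h^-1 *: ((hexp p \o shift 0) (h *: (1 : R)) - hexp p 0) @[h -->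
      0^'] --> (0 : R).
    apply: DeriveDef; first by apply/cvg_ex; exists 0.
    exact/cvg_lim.
  apply/cvgr0Pnorm_lt => e e0.
  near=> h.
  have hn0 : h != 0 by near: h; exact: nbhs_dnbhs_neq.
  rewrite h0 subr0 /= addr0 [h *: 1]mulr1 [_ *: _]/(_ * _) normrM.
  rewrite /hexp; case: ifPn => hpos; last by rewrite normr0 mulr0.
  have := HC h^-1 _; rewrite invr_ge0 (ltW hpos) => /(_ isT).
  rewrite mul1r hornerM hornerXn normrM (ger0_norm (sqr_ge0 _)) => HCh.
  rewrite normrM (ger0_norm (expR_ge0 _)) normfV (gtr0_norm hpos).
  have -> : h^-1 * (`|p.[h^-1]| * expR (- h^-1)) =
      h * (`|p.[h^-1]| * h^-1 ^+ 2 * expR (- h^-1)) by field.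
  rewrite (le_lt_trans (ler_wpM2l (ltW hpos) HCh))//.
  rewrite (@le_lt_trans _ _ (h * (`|C| + 1)))//.
    by rewrite ler_pM2l// (le_trans (ler_norm _))// lerDl.
  rewrite -ltr_pdivlMr ?ltr_wpDl//.
  rewrite (le_lt_trans (ler_norm _))//.
  near: h; apply: dnbhs0_lt; rewrite divr_gt0// ltr_wpDl//.
Unshelve. all: by end_near. Qed.
End hexp.

Section smooth_class.
Context {R : realType} {n : nat}.
Implicit Types (f g : 'rV[R]_n -> R) (x v z : 'rV[R]_n).

(* An algebra of smooth functions closed under partial derivatives, which
   makes iterated Leibniz formulas unnecessary. *)
Inductive bump_alg : ('rV[R]_n -> R) -> Prop :=
| bump_alg_cst c : bump_alg (fun=> c)
| bump_alg_hexp p a i s : bump_alg (fun x => hexp p (a * x 0 i + s))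
| bump_algD f g : bump_alg f -> bump_alg g -> bump_alg (fun x => f x + g x)
| bump_algM f g : bump_alg f -> bump_alg g -> bump_alg (fun x => f x * g x).

Lemma bump_alg_prod I (r : seq I) (F : I -> 'rV[R]_n -> R) :
  (forall i, bump_alg (F i)) -> bump_alg (fun x => \prod_(i <- r) F i x).
Proof.
move=> HF; elim: r => [|i r IH].
  by under eq_fun do rewrite big_nil; exact: bump_alg_cst.
by under eq_fun do rewrite big_cons; exact: bump_algM.
Qed.

Lemma bump_alg_bounded f : bump_alg f -> exists C, forall x, `|f x| <= C.
Proof.
elim=> {f} [c|p a i s|f g _ [C fC] _ [D gD]|f g _ [C fC] _ [D gD]].
- by exists `|c|.
- by have [C HC] := hexp_bounded p; exists C.
- by exists (C + D) => x; rewrite (le_trans (ler_normD _ _))// lerD.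
- by exists (C * D) => x; rewrite normrM ler_pM.
Qed.

Lemma bump_alg_shift f z : bump_alg f -> bump_alg (fun x => f (x + z)).
Proof.
elim=> {f} [c|p a i s|f g _ fz _ gz|f g _ fz _ gz].
- exact: bump_alg_cst.
- under eq_fun do rewrite mxE mulrDr -addrA.
  exact: bump_alg_hexp.
- exact: bump_algD.
- exact: bump_algM.
Qed.

Lemma continuous_hexp p : continuous (@hexp R p).
Proof.
move=> x; apply: differentiable_continuous; apply/derivable1_diffP.
by have [] := is_derive_hexp p x.
Qed.

Lemma continuous_bump_alg f : bump_alg f -> continuous f.
Proof.
elim=> {f} [c|p a i s|f g _ cf _ cg|f g _ cf _ cg] x.
- exact: cst_continuous.
- apply: (@continuous_comp _ _ _ (fun x : 'rV[R]_n => a * x 0 i + s) (hexp p));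
  last exact: continuous_hexp.
  apply: continuousD; last exact: cst_continuous.
  by apply: continuousM; [exact: cst_continuous|exact: coord_continuous].
- exact: (continuousD (cf x) (cg x)).
- exact: (continuousM (cf x) (cg x)).
Qed.

(** Derivatives along all lines, with a gradient inside the algebra, are what mean value arguments
    and differentiation under the integral need, and they follow from one-variable rules. *)
Lemma bump_alg_is_derive f : bump_alg f -> exists D : 'I_n -> 'rV[R]_n -> R,
  (forall i, bump_alg (D i)) /\
  forall x v (t : R), is_derive t 1 (fun t : R => f (x + t *: v))
    (\sum_i v 0 i * D i (x + t *: v)).
Proof.
elim=> {f} [c|p a i s|f g bf [D [bD fD]] bg [E [bE gE]]|f g bf [D [bD fD]] bg [E
  [bE gE]]].
- exists (fun _ _ => 0); split; first by move=> i; exact: bump_alg_cst.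
  move=> x v t; rewrite big1 => [|i _]; last by rewrite mulr0.
  exact: is_derive_cst.
- exists (fun j x => (if j == i then a else 0) * hexp ((p - p^`()) * 'X^2) (a *
  x 0 i + s)).
  split=> [j|x v t].
    by apply: bump_algM; [exact: bump_alg_cst|exact: bump_alg_hexp].
  rewrite (bigD1 i)//= eqxx big1 ?addr0; last first.
    by move=> j /negbTE ->; rewrite mul0r mulr0.
  have dl : is_derive t 1 (fun t : R => a * (x + t *: v) 0 i + s) (a * v 0 i).
    have -> : (fun t : R => a * (x + t *: v) 0 i + s) =
        (fun t : R => (a * v 0 i) * t + (a * x 0 i + s)).
      by apply/funext => r; rewrite !mxE; ring.
    apply: is_derive_eq; rewrite [_ *: _]mulr1 addr0; done.
  apply: is_derive_eq (@is_derive1_comp R (hexp p) _ t _ _ (is_derive_hexp _ _)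
    dl) _.
  by ring.
- exists (fun i x => D i x + E i x); split=> [i|x v t]; first exact: bump_algD.
  apply: is_derive_eq (is_deriveD (fD x v t) (gE x v t)) _.
  by rewrite -big_split/=; apply: eq_bigr => i _; rewrite mulrDr.
- exists (fun i x => D i x * g x + f x * E i x); split=> [i|x v t].
    by apply: bump_algD; apply: bump_algM.
  apply: is_derive_eq (is_deriveM (fD x v t) (gE x v t)) _.
  rewrite /GRing.scale/= !mulr_sumr -big_split/=; apply: eq_bigr => i _; ring.
Qed.

Lemma bump_alg_deriveE f (D : 'I_n -> 'rV[R]_n -> R) :
  (forall x v (t : R), is_derive t 1 (fun t : R => f (x + t *: v))
    (\sum_i v 0 i * D i (x + t *: v))) ->
  forall i x, derivable f x (delta_mx 0 i) /\ partial i f x = D i x.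
Proof.
move=> fD i x; have [df Df] := fD x (delta_mx 0 i) 0.
have E : (fun h : R => h^-1 *: (((fun t : R => f (x + t *:
    delta_mx 0 i)) \o shift 0) (h *: 1) -
      f (x + 0 *: delta_mx 0 i))) =
    (fun h : R => h^-1 *: ((f \o shift x) (h *: delta_mx 0 i) - f x)).
  apply/funext => h /=; rewrite addr0 [h *: (1 : R)]mulr1 scale0r addr0.
  by rewrite [x + _]addrC.
split; first by move: df; rewrite /derivable E.
rewrite /partial /derive; move: Df; rewrite /derive E scale0r addr0 => ->.
rewrite (bigD1 i)//= mxE !eqxx mul1r big1 ?addr0// => j ji.
by rewrite mxE (negbTE ji) andbF mul0r.
Qed.

Lemma bump_alg_partial f i : bump_alg f -> bump_alg (partial i f).
Proof.
move=> /bump_alg_is_derive[D [bD /bump_alg_deriveE fD]].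
by rewrite (_ : partial i f = D i)//; apply/funext => x; case: (fD i x).
Qed.

Lemma bump_alg_smooth f : bump_alg f -> smooth f.
Proof.
move=> bf s; have {}bf : bump_alg (iter_partial s f).
  by elim: s => //= i s; exact: bump_alg_partial.
split=> [|i x]; first exact: continuous_bump_alg.
by have [D [_ /bump_alg_deriveE fD]] := bump_alg_is_derive bf; case: (fD i x).
Qed.

Definition bounded_support f := exists r : R, forall x, f x != 0 -> `|x| <= r.

Lemma compact_norm_le (r : R) : compact [set x : 'rV[R]_n | `|x| <= r].
Proof.
apply: bounded_closed_compact.
  exists r; split; first exact: num_real.
  by move=> M rM x /= /le_trans; apply; exact: ltW.
rewrite (_ : [set _ | _] = (fun x : 'rV[R]_n => `|x|) @^-1` [set y : R | y <= r])//.
by apply: closed_comp; [move=> x _; exact: norm_continuous|exact: closed_le].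
Qed.

Lemma bounded_support_compact f : bounded_support f -> compactly_supported f.
Proof.
move=> [r fr]; have cB := @compact_norm_le r.
apply: (subclosed_compact (@closed_closure _ _) cB).
have /closure_id -> := compact_closed (@norm_hausdorff _ _) cB.
by apply: closure_subset => x /=; exact: fr.
Qed.

Definition bump f := bump_alg f /\ bounded_support f.

Lemma bump_test_function f : bump f -> test_function f.
Proof.
by move=> [bf sf]; split; [exact: bump_alg_smooth|exact: bounded_support_compact].
Qed.

End smooth_class.

Section bump_theory.
Context {R : realType} {n : nat}.
Implicit Types (f g : 'rV[R]_n -> R) (x v z : 'rV[R]_n).

Lemma bumpD f g : bump f -> bump g -> bump (fun x => f x + g x).
Proof.
move=> [bf [r fr]] [bg [s gs]]; split; first exact: bump_algD.
exists (Num.max r s) => x; rewrite le_max; have [->|/fr ->//] := eqVneq (f x) 0.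
by rewrite add0r => /gs ->; rewrite orbT.
Qed.

Lemma bumpZ c f : bump f -> bump (fun x => c * f x).
Proof.
move=> [bf [r fr]]; split; first by apply: bump_algM => //; exact: bump_alg_cst.
by exists r => x; rewrite mulf_eq0 negb_or => /andP[_]; exact: fr.
Qed.

Lemma bump_shift f z : bump f -> bump (fun x => f (x + z)).
Proof.
move=> [bf [r fr]]; split; first exact: bump_alg_shift.
exists (r + `|z|) => x /fr xz; rewrite -(addrK z x) (le_trans (ler_normB _ _))//.
by rewrite lerD.
Qed.

Lemma coord_le_norm x i : `|x 0 i| <= `|x|.
Proof. by rewrite -[leRHS]/(mx_norm x) mx_normrE (le_bigmax _ (fun ij =>
  `|x ij.1 ij.2|) (0, i)). Qed.

Lemma norm_le_coord x r : 0 <= r -> (forall i, `|x 0 i| <= r) -> `|x| <= r.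
Proof.
move=> r0 xr; rewrite -[leLHS]/(mx_norm x) mx_normrE; apply: bigmax_le =>
  //= -[i j] _ /=.
by rewrite ord1.
Qed.

Lemma bump_alg_lipschitz f : bump_alg f ->
  exists2 L, 0 <= L & forall x v, `|f (x + v) - f x| <= L * `|v|.
Proof.
move=> /bump_alg_is_derive[D [bD fD]].
have /choice[C HC] := fun i => bump_alg_bounded (bD i).
have C0 i : 0 <= C i by apply: le_trans (HC i 0).
exists (\sum_i C i) => [|x v]; first exact: sumr_ge0.
have cF : {within `[0, 1], continuous (fun t : R => f (x + t *: v))}.
  apply: derivable_within_continuous => t _.
  by have [] := fD x v t.
have [t _] := MVT ltr01 (fun t _ => fD x v t) cF.
rewrite scale1r scale0r addr0 subr0 mulr1 => ->.
rewrite (le_trans (ler_norm_sum _ _ _))// mulr_suml ler_sum// => i _.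
by rewrite normrM mulrC ler_pM// coord_le_norm.
Qed.

Definition open_box (a b : 'rV[R]_n) : set 'rV[R]_n :=
  [set x | forall i, a 0 i < x 0 i < b 0 i].

(* As k goes to infinity, hexp 1 (k t) tends to the indicator of t > 0, hence
   box_bump a b k tends to the indicator of the box. *)
Definition box_bump (a b : 'rV[R]_n) (k : nat) x :=
  \prod_i (hexp 1 (k%:R * (x 0 i - a 0 i)) * hexp 1 (k%:R * (b 0 i - x 0 i))).

Lemma box_bump_out a b k x : ~ open_box a b x -> box_bump a b k x = 0.
Proof.
move=> /existsNP[i /negP]; rewrite negb_and -!leNgt => xi.
rewrite /box_bump (bigD1 i)//= /hexp.
case/orP: xi => xi.
  by rewrite ltNge mulr_ge0_le0 ?subr_le0// !mul0r.
by rewrite [X in _ * (if X then _ else _)]ltNge mulr_ge0_le0 ?subr_le0//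
  mulr0 mul0r.
Qed.

Lemma box_bump_supp a b k x : box_bump a b k x != 0 -> `|x| <= Num.max `|a| `|b|.
Proof.
have [xab _|/box_bump_out ->] := pselect (open_box a b x); last by rewrite eqxx.
apply: norm_le_coord => [|i]; first by rewrite le_max normr_ge0.
have /andP[ax xb] := xab i; rewrite ler_norml le_max lerNl le_max.
have := coord_le_norm a i; have := coord_le_norm b i; rewrite !ler_norml =>
    /andP[_ bb] /andP[aa _].
by rewrite [_ <= `|a|]lerNl (le_trans aa (ltW ax))//= [x 0 i <= `|b|](le_trans
  (ltW xb) bb) orbT.
Qed.

Lemma bump_box_bump a b k : bump (box_bump a b k).
Proof.
split.
  apply: bump_alg_prod => i; apply: bump_algM.
    under eq_fun do rewrite mulrBr; exact: bump_alg_hexp.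
  under eq_fun do rewrite mulrBr addrC -mulNr; exact: bump_alg_hexp.
by exists (Num.max `|a| `|b|) => x; exact: box_bump_supp.
Qed.

Lemma box_bump_ge0 a b k x : 0 <= box_bump a b k x.
Proof. by apply: prodr_ge0 => i _; rewrite mulr_ge0// hexp_ge0. Qed.

Lemma box_bump_le1 a b k x : box_bump a b k x <= 1.
Proof.
apply: prodr_ile1 => i _; rewrite mulr_ge0 ?hexp_ge0//=.
by rewrite mulr_ile1 ?hexp_ge0 ?hexp_le1.
Qed.

Lemma cvg_hexp_natmul (t : R) : 0 < t -> hexp 1 (k%:R * t) @[k --> \oo] --> (1 : R).
Proof.
move=> t0.
apply/cvgrPdist_le => e e0; near=> k.
have k0 : 0 < k%:R :> R by rewrite ltr0n; near: k; exact: nbhs_infty_gt.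
have kt0 : 0 < k%:R * t by rewrite mulr_gt0.
rewrite ger0_norm ?subr_ge0 ?hexp_le1// /hexp kt0 hornerC mul1r.
have := expR_ge1Dx (- (k%:R * t)^-1) => H.
rewrite (@le_trans _ _ ((k%:R * t)^-1))//; first by move: H; lra.
rewrite -[e]invrK lef_pV2 ?posrE ?invr_gt0// -ler_pdivrMr//.
by near: k; exact: nbhs_infty_ger.
Unshelve. all: by end_near. Qed.

Lemma cvg_box_bump a b x : box_bump a b k x @[k --> \oo] -->
    (\1_(open_box a b) x : R).
Proof.
rewrite indicE; case: (boolP (x \in open_box a b)) => [|].
  rewrite inE => xab.
  rewrite [X in _ --> X](_ : _ = \prod_(i < n) (1 * 1)); last first.
    by rewrite big1// => i _; rewrite mulr1.
  apply: cvg_big => [|i _]; first exact: mul_continuous.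
  have /andP[ax xb] := xab i.
  by apply: cvgM; apply: cvg_hexp_natmul; rewrite subr_gt0.
rewrite notin_setE => xab.
under eq_fun do rewrite box_bump_out//.
exact: cvg_cst.
Qed.

End bump_theory.

(** * A monotone class principle for bump functions *)

Section density.
Context {R : realType} {n : nat}.
Implicit Types (f g : 'rV[R]_n -> R) (x v z : 'rV[R]_n).

Lemma measurable_open_box (a b : 'rV[R]_n) : measurable (open_box a b).
Proof.
have -> : open_box a b =
    \bigcap_i ((fun x : 'rV[R]_n => x 0 i) @^-1` `]a 0 i, b 0 i[%classic).
  apply/seteqP; split => [x xab i _|x xab i] /=.
    by rewrite in_itv/= xab.
  by have := xab i I; rewrite /= in_itv.
apply: fin_bigcap_measurable; first exact: finite_finset.
by move=> i _; rewrite -[X in measurable X]setTI; exact: measurable_coord.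
Qed.

(** Balls of the sup norm are open boxes, and every open set is a countable union of balls with
    rational centers. Boxes are stable under intersection, as the Dynkin argument below requires. *)
Lemma measurable_open_boxE : @measurable _ 'rV[R]_n =
  <<s [set open_box ab.1 ab.2 | ab in [set: 'rV[R]_n * 'rV[R]_n]] >>.
Proof.
apply/seteqP; split; last first.
  apply: smallest_sub; first exact: sigma_algebra_measurable.
  by move=> _ [[a b] _ <-] /=; exact: measurable_open_box.
apply: smallest_sub; first exact: smallest_sigma_algebra.
move=> U oU; rewrite (open_rV_bigcup oU) bigcup_mkcond.
set G := [set open_box _ _ | _ in _].
apply: (@countable_bigcupT_measurable _ (g_sigma_algebraType G)) => // -[q k].
case: ifPn => // _; apply: sub_sigma_algebra.
set e := k.+1%:R^-1; have e0 : 0 < e :> R by rewrite invr_gt0.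
pose c : 'rV[R]_n := map_mx ratr q.
exists (c - const_mx e, c + const_mx e) => //=.
apply/seteqP; split => x /= xc.
  split=> // i j; rewrite ord1 -/c /ball/= ltr_norml.
  by have := xc j; rewrite !mxE -/(e : R); lra.
by case: xc => _ xc i; have := xc 0 i; rewrite -/c /ball/= ltr_norml !mxE; lra.
Qed.

Lemma setI_closed_open_box :
  setI_closed [set open_box ab.1 ab.2 | ab in [set: 'rV[R]_n * 'rV[R]_n]].
Proof.
move=> _ _ [[a b] _ <-] [[c d] _ <-] /=.
exists (\row_i Num.max (a 0 i) (c 0 i), \row_i Num.min (b 0 i) (d 0 i)) => //=.
apply/seteqP; split => [x H|x [H1 H2] i].
  by split=> i; have := H i; rewrite !mxE gt_max lt_min; lra.
have := H1 i; have := H2 i; rewrite !mxE gt_max lt_min => /andP[-> ->] /andP[-> ->].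
by [].
Qed.

Section induction.
Variable K : ('rV[R]_n -> R) -> Prop.
Hypothesis K_bump : forall f, bump f -> K f.
Hypothesis K_lin : forall a f g, K f -> K g -> K (fun x => a * f x + g x).
Hypothesis K_lim : forall (F : nat -> 'rV[R]_n -> R) f (C r : R),
  (forall k, K (F k)) -> (forall k x, `|F k x| <= C) ->
  (forall k x, F k x != 0 -> `|x| <= r) ->
  (forall x, F k x @[k --> \oo] --> f x) -> K f.

Let K0 : K (fun=> 0).
Proof. by apply: K_bump; split; [exact: bump_alg_cst|exists 0 => x;
  rewrite eqxx]. Qed.

Let K_sum m (c : nat -> R) (F : nat -> 'rV[R]_n -> R) : (forall k, K (F k)) ->
  K (fun x => \sum_(k < m) c k * F k x).
Proof.
move=> KF; elim: m => [|m IH]; first by under eq_fun do rewrite big_ord0.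
under eq_fun do rewrite big_ord_recr/= addrC.
exact: K_lin.
Qed.

(** The whole space has to belong to the Dynkin class, but its indicator has unbounded support:
    every set is first cut by the cube [Q r]. *)
Let Q (r : R) : set 'rV[R]_n := open_box (const_mx (- r)) (const_mx r).

Let norm_Q r x : 0 <= r -> x \in Q r -> `|x| <= r.
Proof.
move=> r0; rewrite inE => xr; apply: norm_le_coord => // i.
by have := xr i; rewrite !mxE ler_norml => /andP[/ltW -> /ltW ->].
Qed.

Let indicI_le1 r (E : set 'rV[R]_n) x : `|\1_(E `&` Q r) x : R| <= 1.
Proof. by rewrite indicE; case: (_ \in _); rewrite ?normr1 ?normr0. Qed.

Let indicI_supp r (E : set 'rV[R]_n) x : 0 <= r -> (\1_(E `&` Q r) x :
  R) != 0 -> `|x| <= r.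
Proof.
by move=> r0; rewrite indicE pnatr_eq0 eqb0 negbK in_setI => /andP[_]; exact:
  norm_Q.
Qed.

Let K_box r (a b : 'rV[R]_n) : 0 <= r -> K (\1_(open_box a b `&` Q r)).
Proof.
move=> r0.
have [[c d] _ /= <-] := setI_closed_open_box (imageT _ (a,
    b)) (imageT _ (const_mx (- r), const_mx r)).
apply: (@K_lim (box_bump c d) _ 1 (Num.max `|c| `|d|)).
- by move=> k; exact/K_bump/bump_box_bump.
- by move=> k x; rewrite ger0_norm ?box_bump_ge0 ?box_bump_le1.
- move=> k x; exact: box_bump_supp.
- exact: cvg_box_bump.
Qed.

Let K_indic r (E : set 'rV[R]_n) : 0 <= r -> measurable E -> K (\1_(E `&` Q r)).
Proof.
move=> r0 mE.
apply: (dynkin_induction measurable_open_boxE setI_closed_open_box (P := fun E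
  => K (\1_(E `&` Q r)))) => //.
- have := K_box (const_mx (-r)) (const_mx r) r0.
  by rewrite setIid setTI.
- by move=> _ [[a b] _ <-]; exact: K_box.
- move=> S mS KS; have KQ : K (\1_(Q r)).
    by have := K_box (const_mx (-r)) (const_mx r) r0; rewrite setIid.
  rewrite (_ : \1_(~` S `&` Q r) = fun x => -1 * \1_(S `&` Q r) x + \1_(Q r) x);
    first exact: K_lin.
  apply/funext => x; rewrite !indicE !in_setI in_setC.
  by case: (x \in S); case: (x \in Q r); rewrite /=; ring.
- move=> F mF tF KF.
  (* Indicators of finite disjoint unions are sums, hence in the class; that of the countable union
     is their limit, with bound 1 and common support in the cube. *)
  pose U m := [set x | exists2 k, (k < m)%N & F k x].
  have KU m : K (\1_(U m `&` Q r)).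
    elim: m => [|m IH].
      rewrite (_ : \1_(_ `&` _) = fun=> 0)//; apply/funext => x.
      by rewrite indicE memNset// => -[[]].
    rewrite (_ : \1_(_ `&` _) = fun x => 1 * \1_(F m `&` Q r) x + \1_(U m `&` Q
      r) x).
      exact: K_lin.
    apply/funext => x; rewrite !indicE !in_setI mul1r.
    have [xQ|] := boolP (x \in Q r); last by rewrite !andbF addr0.
    rewrite !andbT; have [xF|xF] := boolP (x \in F m).
      rewrite mem_set ?memNset ?addr0//; last first.
        by exists m => //; exact: set_mem.
      move=> [k km Fk]; have := tF k m I I; move: km; rewrite ltn_neqAle =>
        /andP[/eqP km _].
      by move=> H; apply/km/H; exists x; split => //; exact: set_mem.
    rewrite add0r; congr (_%:R); congr nat_of_bool; apply/idP/idP;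
      rewrite !inE => -[k km Fk].
      exists k => //; move: km; rewrite ltnS leq_eqVlt => /predU1P[km|//].
      by move: xF; rewrite -km mem_set.
    by exists k => //; exact: ltnW.
  apply: (@K_lim (fun m => \1_(U m `&` Q r)) _ 1 r) => //.
  + by move=> m x; exact: indicI_supp.
  + move=> x; have [[k _ Fk]|nF] := pselect ((\bigcup_k F k) x).
      apply: cvg_near_cst; near=> m.
      rewrite !indicE !in_setI (@mem_set _ (U m)).
        by rewrite (@mem_set _ (\bigcup_k F k))//; exists k.
      by exists k => //; near: m; exact: nbhs_infty_gt.
    rewrite (_ : (fun m => _) = fun=> \1_(\bigcup_k F k `&` Q r) x).
      exact: cvg_cst.
    apply/funext => m; rewrite !indicE !in_setI (memNset nF) memNset//.
    by move=> [k _ Fk]; apply: nF; exists k.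
- by rewrite -measurable_open_boxE.
Unshelve. all: by end_near. Qed.

(** A functional monotone class theorem. Limits are uniformly bounded with a common bounded support,
    which makes them dominated limits in both applications: density in L2 and the du Bois-Reymond
    lemma. *)
Lemma bounded_borel_ind f : measurable_fun setT f -> (exists C : R, forall x,
    `|f x| <= C) ->
  bounded_support f -> K f.
Proof.
suff pos g : measurable_fun setT g -> (forall x, 0 <= g x) -> (exists C : R,
    forall x, `|g x| <= C) ->
    bounded_support g -> K g.
  move=> mf [C fC] [r fr].
  rewrite (_ : f = fun x => -1 * Num.max (- f x) 0 + Num.max (f x) 0); last first.
    by apply/funext => x; rewrite !maxEle; case: ifPn; case: ifPn; lra.
  apply: K_lin; apply: pos.
  - by apply: measurable_maxr => //; exact: measurable_funN.
  - by move=> x; rewrite le_max lexx orbT.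
  - exists C => x; rewrite (le_trans _ (fC x))// ger0_norm ?le_max ?lexx ?orbT//
    ge_max normr_ge0 andbT.
    by rewrite -normrN ler_norm.
  - exists r => x; have [fx0|/fr//] := eqVneq (f x) 0.
    by rewrite fx0 oppr0 maxxx eqxx.
  - exact: measurable_maxr.
  - by move=> x; rewrite le_max lexx orbT.
  - exists C => x; rewrite (le_trans _ (fC x))// ger0_norm ?le_max ?lexx ?orbT//
    ge_max normr_ge0 andbT.
    exact: ler_norm.
  - exists r => x; have [fx0|/fr//] := eqVneq (f x) 0.
    by rewrite fx0 maxxx eqxx.
move=> mg g0 [C gC] [r gr].
have mg' : measurable_fun setT (EFin \o g) by exact/measurable_EFinP.
pose h := nnsfun_approx measurableT mg'.
have hg k x : h k x <= g x.
  rewrite -lee_fin /h nnsfun_approxE.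
  by apply: le_approx => // y _; rewrite lee_fin.
have {}gr x : g x != 0 -> x \in Q (`|r| + 1).
  move=> /gr xr; rewrite inE => i; rewrite !mxE -ltr_norml.
  rewrite (le_lt_trans (coord_le_norm _ _))// (le_lt_trans xr)//.
  by rewrite (le_lt_trans (ler_norm r))// ltrDl.
have h0 k x : x \notin Q (`|r| + 1) -> h k x = 0.
  move=> xQ; apply/eqP; rewrite eq_le fun_ge0 andbT (le_trans (hg k x))//.
  by have [->//|/gr] := eqVneq (g x) 0; rewrite (negbTE xQ).
have r10 : 0 <= `|r| + 1 by rewrite addr_ge0.
(* The simple functions below [g] vanish off the cube, so their level sets may be cut by it. *)
apply: (@K_lim (fun k => h k) _ C (`|r| + 1)).
- move=> k; pose s := finmap.enum_fset (fset_set (range (h k))).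
  rewrite (_ : HBNNSimple.NonNegSimpleFun.sort (h k) = fun x =>
    \sum_(i < size s) s`_i * \1_(h k @^-1` [set s`_i] `&` Q (`|r| + 1)) x);
    last first.
    apply/funext => x; have [xQ|xQ] := boolP (x \in Q (`|r| + 1)).
      rewrite [LHS]fimfunEord; apply: eq_bigr => i _.
      by rewrite !indicE in_setI xQ andbT.
    rewrite h0// big1// => i _.
    by rewrite indicE in_setI (negbTE xQ) andbF mulr0.
  apply: (K_sum (size s) (fun i => s`_i) (F := fun i =>
    \1_(h k @^-1` [set s`_i] `&` Q (`|r| + 1)))) => i.
  exact: K_indic.
- by move=> k x; rewrite ger0_norm ?fun_ge0// (le_trans (hg k x))//
  (le_trans (ler_norm _)).
- move=> k x hx; apply: norm_Q => //; apply: contraNT hx => /h0 ->; exact: eqxx.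
- move=> x; have gx0 y : [set: 'rV[R]_n] y -> (0 <= (EFin \o g) y)%E by rewrite
  lee_fin.
  exact: fine_cvg (cvg_nnsfun_approx measurableT mg' gx0 (I : [set: 'rV[R]_n] x)).
Qed.
End induction.

End density.

(** * Square integrable functions *)

Section square_integrable.
Context d (T : measurableType d) (R : realType) (mu : {measure set T -> \bar R}).
Implicit Types f g : T -> R.

Definition rintegrable f := mu.-integrable setT (EFin \o f).

Lemma rintegrableD f g : rintegrable f -> rintegrable g -> rintegrable (fun x =>
    f x + g x).
Proof.
move=> fi gi; rewrite /rintegrable (_ : _ \o _ = (EFin \o f) \+ (EFin \o g))%E//.
exact: integrableD.
Qed.

Lemma rintegrableZ c f : rintegrable f -> rintegrable (fun x => c * f x).
Proof. by move=> fi; exact: (integrableZl measurableT c fi). Qed.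

Lemma rintegrableB f g : rintegrable f -> rintegrable g -> rintegrable (fun x =>
    f x - g x).
Proof.
move=> fi gi; have := rintegrableD fi (rintegrableZ (-1) gi).
by under eq_fun do rewrite mulN1r.
Qed.

Lemma rintegrable_sum I (r : seq I) (F : I -> T -> R) :
  (forall i, rintegrable (F i)) -> rintegrable (fun x => \sum_(i <- r) F i x).
Proof.
move=> HF; elim: r => [|i r IH].
  by under eq_fun do rewrite big_nil; exact: integrable0.
by under eq_fun do rewrite big_cons; exact: rintegrableD.
Qed.

Lemma le_rintegrable f g : measurable_fun setT f -> (forall x, `|f x| <= g x) ->
  rintegrable g -> rintegrable f.
Proof.
move=> mf fg; apply: le_integrable => //; first exact/measurable_EFinP.
by move=> x _ /=; rewrite lee_fin (le_trans (fg x))// ler_norm.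
Qed.

Lemma rintegrableP f : measurable_fun setT f -> (forall x, 0 <= f x) ->
  (\int[mu]_x (f x)%:E < +oo)%E -> rintegrable f.
Proof.
move=> mf f0 fi; apply/integrableP; split; first exact/measurable_EFinP.
by under eq_integral => x _ do rewrite /= ger0_norm//.
Qed.

Lemma EFin_rintegral f : rintegrable f ->
  (\int[mu]_x (f x)%:E)%E = (\int[mu]_x f x)%:E.
Proof. by move=> fi; rewrite fineK//; exact: integrable_fin_num. Qed.

Lemma Rintegral_sum I (r : seq I) (F : I -> T -> R) : (forall i,
    rintegrable (F i)) ->
  \int[mu]_x (\sum_(i <- r) F i x) = \sum_(i <- r) \int[mu]_x F i x.
Proof.
move=> HF; elim: r => [|i r IH].
  by under eq_Rintegral do rewrite big_nil; rewrite Rintegral_cst// mul0r big_nil.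
under eq_Rintegral do rewrite big_cons.
rewrite RintegralD//; [by rewrite IH big_cons|exact: HF|exact: rintegrable_sum].
Qed.

Definition square_integrable f :=
  measurable_fun setT f /\ rintegrable (fun x => f x ^+ 2).

Definition sqnorm f : R := \int[mu]_x (f x ^+ 2).

Lemma sqnorm_ge0 f : 0 <= sqnorm f.
Proof. by apply: Rintegral_ge0 => x _; exact: sqr_ge0. Qed.

Lemma rintegrableM f g : square_integrable f -> square_integrable g ->
  rintegrable (fun x => f x * g x).
Proof.
move=> [mf fi] [mg gi]; apply: (@le_rintegrable _ (fun x => f x ^+ 2 + g x ^+ 2)).
- exact: measurable_funM.
- move=> x; rewrite normrM -(real_normK (num_real (f x))) -(real_normK (num_real
  (g x))).
  have := sqr_ge0 (`|f x| - `|g x|); have := mulr_ge0 (normr_ge0 (f x))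
      (normr_ge0 (g x)); nra.
- exact: rintegrableD.
Qed.

Lemma square_integrableD f g : square_integrable f -> square_integrable g ->
  square_integrable (fun x => f x + g x).
Proof.
move=> sf sg; have [mf fi] := sf; have [mg gi] := sg.
split; first exact: measurable_funD.
under eq_fun do rewrite sqrrD -mulr_natl.
by apply: rintegrableD => //; apply: rintegrableD => //;
  apply/rintegrableZ/rintegrableM.
Qed.

Lemma square_integrableZ c f : square_integrable f ->
  square_integrable (fun x => c * f x).
Proof.
move=> [mf fi]; split; first exact: measurable_funM.
by under eq_fun do rewrite exprMn; exact: rintegrableZ.
Qed.

Lemma square_integrableB f g : square_integrable f -> square_integrable g ->
  square_integrable (fun x => f x - g x).
Proof.
move=> sf sg; have := square_integrableD sf (square_integrableZ (-1) sg).
by under eq_fun do rewrite mulN1r.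
Qed.

Lemma square_integrable_sum I (r : seq I) (F : I -> T -> R) :
  (forall i, square_integrable (F i)) -> square_integrable (fun x =>
    \sum_(i <- r) F i x).
Proof.
move=> HF; elim: r => [|i r IH].
  under eq_fun do rewrite big_nil; split => //.
  under eq_fun do rewrite expr0n; exact: integrable0.
by under eq_fun do rewrite big_cons; exact: square_integrableD.
Qed.

Lemma le_square_integrable f g : measurable_fun setT f -> (forall x,
    `|f x| <= `|g x|) ->
  square_integrable g -> square_integrable f.
Proof.
move=> mf fg [mg gi]; split => //; apply: le_rintegrable gi; first exact:
  measurable_funX.
by move=> x; rewrite normrX -(real_normK (num_real (g x))) lerXn2r ?nnegrE.
Qed.

Lemma sqnormD_le f g : square_integrable f -> square_integrable g ->
  sqnorm (fun x => f x + g x) <= 2 * sqnorm f + 2 * sqnorm g.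
Proof.
move=> sf sg; have [_ fi] := sf; have [_ gi] := sg.
rewrite /sqnorm -!RintegralZl// -RintegralD//; [|exact: rintegrableZ..].
apply: le_Rintegral => //; first by case: (square_integrableD sf sg).
  by apply: rintegrableD; exact: rintegrableZ.
by move=> x _; have := sqr_ge0 (f x - g x); nra.
Qed.

Lemma sqnormZ c f : square_integrable f -> sqnorm (fun x =>
    c * f x) = c ^+ 2 * sqnorm f.
Proof.
by move=> [_ fi]; rewrite /sqnorm; under eq_Rintegral do rewrite exprMn;
  rewrite RintegralZl.
Qed.

End square_integrable.

Section L2_rV.
Context {R : realType} {n : nat}.
Implicit Types (f g : 'rV[R]_n -> R) (x z : 'rV[R]_n).
Local Notation leb := (@lebesgue_rV R n).

Lemma measurable_norm_rV : measurable_fun setT (fun x : 'rV[R]_n => `|x|).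
Proof.
apply: (measurability _ (RGenOInfty.measurableE R)) => // _ [_ [a ->] <-].
rewrite setTI; apply: open_measurable_rV.
by apply: open_comp => // x _; exact: norm_continuous.
Qed.

Lemma measurable_norm_le (r : R) : measurable [set x : 'rV[R]_n | `|x| <= r].
Proof.
have := measurable_norm_rV measurableT (measurable_itv `]-oo, r]).
by rewrite setTI; congr (measurable _).
Qed.

Lemma lebesgue_norm_le (r : R) : (leb [set x : 'rV[R]_n | (`|x| <= r)%R] < +oo)%E.
Proof.
pose s : R := `|r|; have s0 : 0 <= s by exact: normr_ge0.
set B := [set x : 'rV[R]_n | forall i, x 0 i \in `](const_mx (- (s + 1)) :
  'rV[R]_n) 0 i, (const_mx s : 'rV[R]_n) 0 i]].
have mB : measurable B.
  rewrite (_ : B = \bigcap_i ((fun x : 'rV[R]_n => x 0 i) @^-1` `](- (s + 1)),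
    s]%classic)).
    apply: fin_bigcap_measurable; first exact: finite_finset.
    by move=> i _; rewrite -[X in measurable X]setTI; exact: measurable_coord.
  by apply/seteqP; split=> [x Bx i _|x Bx i]; [have := Bx i|have := Bx i I];
    rewrite !mxE.
apply: (@le_lt_trans _ _ (leb B)).
  apply: le_measure; rewrite ?inE//; first exact: measurable_norm_le.
  move=> x /= xr i; rewrite !mxE in_itv/=.
  have := le_trans (coord_le_norm x i) xr => /le_trans /(_ (ler_norm _));
      rewrite -/s ler_norml.
  by move=> /andP[]; lra.
by rewrite lebesgue_rV_box ?ltry// => i; rewrite !mxE; lra.
Qed.

Lemma bounded_borel_rintegrable f (C : R) : measurable_fun setT f ->
  (forall x, `|f x| <= C) -> bounded_support f -> rintegrable leb f.
Proof.
move=> mf fC [r fr].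
apply: (@le_rintegrable _ _ _ _ _ (fun x => C * \1_[set x :
  'rV[R]_n | `|x| <= r] x)) => //.
  move=> x; rewrite indicE; have [fx|/fr xr] := eqVneq (f x) 0;
    last by rewrite mem_set// mulr1.
  by rewrite fx normr0 mulr_ge0// (le_trans (normr_ge0 (f x))).
have mB := measurable_norm_le r; apply: rintegrableZ; apply: rintegrableP.
- exact: measurable_indic.
- by move=> x; rewrite indicE.
- by rewrite integral_indic// setIT; exact: lebesgue_norm_le.
Qed.

Lemma bounded_borel_square_integrable f (C : R) : measurable_fun setT f ->
  (forall x, `|f x| <= C) -> bounded_support f -> square_integrable leb f.
Proof.
move=> mf fC [r fr]; split => //; apply: (@bounded_borel_rintegrable _ (C ^+ 2)).
- exact: measurable_funX.
- by move=> x; rewrite normrX lerXn2r ?nnegrE// (le_trans (normr_ge0 (f x))).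
- by exists r => x; rewrite expf_eq0/= => /fr.
Qed.

Lemma square_integrable_indic_norm_le (r : R) :
  square_integrable leb (\1_[set x : 'rV[R]_n | `|x| <= r]).
Proof.
apply: (@bounded_borel_square_integrable _ 1).
- by apply: measurable_indic; exact: measurable_norm_le.
- by move=> x; rewrite indicE; case: (_ \in _); rewrite ?normr0 ?normr1.
- exists r => x; rewrite indicE; case: (boolP (x \in _)); first by rewrite inE.
  by rewrite eqxx.
Qed.

Lemma continuous_measurable_rV f : continuous f -> measurable_fun setT f.
Proof.
move=> cf; apply: (measurability _ (RGenOInfty.measurableE R)) => //
  _ [_ [a ->] <-].
rewrite setTI; apply: open_measurable_rV.
by apply: open_comp => // x _; exact: cf.
Qed.

Lemma bump_borel f : bump f -> [/\ measurable_fun setT f,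
  exists C : R, forall x, `|f x| <= C & bounded_support f].
Proof.
move=> [bf sf]; split => //; last exact: bump_alg_bounded.
by apply: continuous_measurable_rV => x; exact: continuous_bump_alg.
Qed.

Lemma bump_square_integrable f : bump f -> square_integrable leb f.
Proof. by move=> /bump_borel[mf [C fC] sf]; exact:
  bounded_borel_square_integrable sf. Qed.

Lemma rintegrable_shift f z : rintegrable leb f -> rintegrable leb (fun x =>
    f (x + z)).
Proof.
move=> /integrableP[mf fi]; apply/integrableP; split.
  exact: measurableT_comp mf (measurable_shift z).
rewrite (ge0_integral_shift z (f := fun x => `|(f x)%:E|%E))//.
exact: measurableT_comp.
Qed.

Lemma Rintegral_shift f z : measurable_fun setT f ->
  \int[leb]_x f (x + z) = \int[leb]_x f x.
Proof.
move=> mf; rewrite /Rintegral (integral_shift z (f := fun x => (f x)%:E))//.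
exact/measurable_EFinP.
Qed.

Lemma square_integrable_shift f z : square_integrable leb f ->
  square_integrable leb (fun x => f (x + z)).
Proof.
move=> [mf fi]; split; first exact: measurableT_comp mf (measurable_shift z).
exact: (rintegrable_shift z fi).
Qed.

Lemma sqnorm_shift f z : measurable_fun setT f ->
  sqnorm leb (fun x => f (x + z)) = sqnorm leb f.
Proof.
move=> mf; rewrite /sqnorm (Rintegral_shift z (f := fun x => f x ^+ 2))//.
exact: measurable_funX.
Qed.

End L2_rV.

Section dominated.
Context d (T : measurableType d) (R : realType) (mu : {measure set T -> \bar R}).

Lemma rintegrable_dominated (F : nat -> T -> R) (f g : T -> R) :
  (forall k, measurable_fun setT (F k)) -> (forall x, F k x @[k --> \oo] --> f x) ->
  (forall k x, `|F k x| <= g x) -> rintegrable mu g ->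
  rintegrable mu f /\ \int[mu]_x F k x @[k --> \oo] --> \int[mu]_x f x.
Proof.
move=> mF Ff Fg gi.
have mf : measurable_fun setT f by apply: (measurable_fun_cvg mF) => x _; exact: Ff.
have EFf x : [set: T] x -> (F k x)%:E @[k --> \oo] --> (EFin \o f) x.
  by move=> _; apply/fine_cvgP; split; [exact: nearW|exact: Ff].
have EFg x k : [set: T] x -> (`|(F k x)%:E| <= (EFin \o g) x)%E.
  by move=> _; rewrite lee_fin; exact: Fg.
have [fi _ cF] := @dominated_convergence _ _ _ mu _ measurableT
  (fun k x => (F k x)%:E) (EFin \o f) (EFin \o g)
  (fun k => (measurable_EFinP _ _).2 (mF k)) ((measurable_EFinP _ _).2 mf)
  (aeW _ EFf)
  gi (aeW _ EFg).
split=> //; apply: fine_cvg.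
by rewrite -EFin_rintegral.
Qed.

Lemma sqnorm_dominated (F : nat -> T -> R) (f g : T -> R) :
  (forall k, measurable_fun setT (F k)) -> (forall x, F k x @[k --> \oo] --> f x) ->
  (forall k x, `|F k x| <= g x) -> square_integrable mu g ->
  square_integrable mu f /\
  (forall e, 0 < e -> exists k, sqnorm mu (fun x => f x - F k x) <= e).
Proof.
move=> mF Ff Fg [mg gi].
have mf : measurable_fun setT f by apply: (measurable_fun_cvg mF) => x _; exact: Ff.
have fg x : `|f x| <= g x.
  have /cvg_norm cFx := Ff x.
  by apply: (cvgr_to_le cFx); apply: nearW => k; exact: Fg.
have sf : square_integrable mu f.
  apply: le_square_integrable mf _ (conj mg gi) => x.
  by rewrite (le_trans (fg x))// ler_norm.
split=> // e e0.
(* Both |f| and |F k| are at most g, hence the integrable bound 4 g^2 for (f - F k)^2. *)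
have [|x|k x||_] := @rintegrable_dominated (fun k x => (f x - F k x) ^+ 2) (fun=> 0)
    (fun x => 4 * g x ^+ 2).
- by move=> k; apply: measurable_funX; exact: measurable_funB.
- rewrite [X in _ --> X](_ : _ = (f x - f x) ^+ 2); last by rewrite subrr expr0n.
  by apply: cvgM; apply: cvgB => //; exact: cvg_cst.
- have := Fg k x; have := fg x.
  rewrite (ger0_norm (sqr_ge0 _)) !ler_norml => /andP[? ?] /andP[? ?]; nra.
- exact: rintegrableZ.
rewrite Rintegral_cst// mul0r => /cvgr0Pnorm_le /(_ e e0) [k _ Hk]; exists k.
by rewrite (le_trans (ler_norm _))// Hk/=.
Qed.
End dominated.

(** * Density of bump functions and continuity of translations in L2 *)

Section translation_continuity.
Context {R : realType} {n : nat}.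
Implicit Types (f g : 'rV[R]_n -> R) (x z : 'rV[R]_n).
Local Notation leb := (@lebesgue_rV R n).

(** The approximable functions are stable under dominated limits. This gives the bounded Borel
    functions of bounded support by induction, then the general case by cutting off where |x| or the
    function exceeds k. *)
Lemma bump_dense g (e : R) : square_integrable leb g -> 0 < e ->
  exists2 phi, bump phi & sqnorm leb (fun x => g x - phi x) <= e.
Proof.
pose K f := square_integrable leb f /\ forall e : R, 0 < e ->
  exists2 phi, bump phi & sqnorm leb (fun x => f x - phi x) <= e.
suff KK : forall f, square_integrable leb f -> K f by move=> /KK[_ Kg]; exact: Kg.
have Klim (F : nat -> 'rV[R]_n -> R) (f h : 'rV[R]_n -> R) :
    (forall k, K (F k)) -> (forall x, F k x @[k --> \oo] --> f x) ->
    (forall k x, `|F k x| <= h x) -> square_integrable leb h -> K f.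
  move=> KF Ff Fh sh.
  have [sf fF] := sqnorm_dominated (fun k => (KF k).1.1) Ff Fh sh.
  split=> // e' e0; have e40 : 0 < e' / 4 by rewrite divr_gt0.
  have [k Hk] := fF _ e40; have [_ /(_ _ e40)[phi bphi Hphi]] := KF k.
  exists phi => //.
  rewrite (_ : (fun x => _) = fun x => (f x - F k x) + (F k x - phi x)); last first.
    by apply/funext => x; rewrite addrA subrK.
  rewrite (le_trans (sqnormD_le _ _))//.
  - exact: square_integrableB (KF k).1.
  - exact: square_integrableB (KF k).1 (bump_square_integrable bphi).
  - by move: Hk Hphi; lra.
have Kbdd f : measurable_fun setT f -> (exists C : R, forall x, `|f x| <= C) ->
    bounded_support f -> K f.
  apply: bounded_borel_ind => {f}.
  - move=> f bf; split=> [|e' e0]; first exact: bump_square_integrable.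
    exists f => //; rewrite /sqnorm; under eq_Rintegral do rewrite subrr expr0n.
    by rewrite Rintegral_cst// mul0r ltW.
  - move=> a f h [sf Hf] [sh Hh]; split=> [|e' e0].
      by apply: square_integrableD => //; exact: square_integrableZ.
    have e40 : 0 < e' / 4 by rewrite divr_gt0.
    (* The + 1 covers a = 0; in every case a^2 times this constant is at most e' / 4. *)
    have ea0 : 0 < e' / 4 / (a ^+ 2 + 1) by rewrite divr_gt0// ltr_wpDl// sqr_ge0.
    have [phi bphi Hphi] := Hf _ ea0; have [psi bpsi Hpsi] := Hh _ e40.
    exists (fun x => a * phi x + psi x); first exact/bumpD/bpsi/bumpZ.
    have s1 := square_integrableB sf (bump_square_integrable bphi).
    have s2 := square_integrableB sh (bump_square_integrable bpsi).
    rewrite (_ : (fun x => _) = fun x => a * (f x - phi x) + (h x - psi x));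
      last first.
      by apply/funext => x; ring.
    rewrite (le_trans (sqnormD_le _ s2))//; first exact: square_integrableZ.
    rewrite sqnormZ//.
    have : a ^+ 2 * sqnorm leb (fun x => f x - phi x) <= e' / 4.
      rewrite (le_trans (ler_wpM2l (sqr_ge0 a) Hphi))//
        mulrCA ler_piMr ?(ltW e40)//.
      by rewrite ler_pdivrMr ?mul1r ?lerDl// ltr_wpDl// sqr_ge0.
    by move: Hpsi; lra.
  - move=> F f C r KF FC Fr Ff.
    apply: (Klim F f (fun x => C * \1_[set x : 'rV[R]_n | `|x| <= r] x)) => //.
      move=> k x; rewrite indicE; have [fx|/Fr xr] := eqVneq (F k x) 0.
        by rewrite fx normr0 mulr_ge0// (le_trans (normr_ge0 (F k x))).
      by rewrite mem_set// mulr1.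
    apply: (@bounded_borel_square_integrable _ _ _ `|C|).
    - by apply: measurable_funM => //; apply: measurable_indic; exact:
      measurable_norm_le.
    - by move=> x; rewrite normrM indicE ler_piMr//; case: (_ \in _);
      rewrite ?normr0 ?normr1.
    - exists r => x; rewrite indicE; case: (boolP (x \in _)); first by rewrite inE.
      by rewrite mulr0 eqxx.
move=> f sf; have [mf fi] := sf.
pose D k : set 'rV[R]_n := [set x | `|x| <= k%:R] `&` (fun x =>
  `|f x|) @^-1` `]-oo, k%:R].
have mD k : measurable (D k).
  apply: measurableI; first exact: measurable_norm_le.
  rewrite -[X in measurable X]setTI.
  have mnf : measurable_fun setT (fun x => `|f x|) by exact: measurableT_comp.
  exact: mnf.
apply: (Klim (fun k x => f x * \1_(D k) x) f (fun x => `|f x|)).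
- move=> k; apply: Kbdd.
  + by apply: measurable_funM => //; exact: measurable_indic.
  + exists k%:R => x; rewrite indicE; case: (boolP (x \in D k)).
      by rewrite inE mulr1 => -[_]; rewrite /= in_itv.
    by rewrite mulr0 normr0.
  + exists k%:R => x; rewrite indicE; case: (boolP (x \in D k)).
      by rewrite inE => -[].
    by rewrite mulr0 eqxx.
- move=> x; apply: cvg_near_cst; near=> k.
  rewrite indicE mem_set ?mulr1//; split=> /=; last rewrite in_itv/=.
    by near: k; exact: nbhs_infty_ger.
  by near: k; exact: nbhs_infty_ger.
- by move=> k x; rewrite normrM indicE ler_piMr//; case: (_ \in _);
  rewrite ?normr0 ?normr1.
- by apply: le_square_integrable sf => [|x]; [exact:
  measurableT_comp|rewrite normr_id].
Unshelve. all: by end_near. Qed.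

Lemma translation_continuous_L2 g (e : R) : square_integrable leb g -> 0 < e ->
  exists2 del, 0 < del & forall z, `|z| <= del ->
    sqnorm leb (fun x => g (x + z) - g x) <= e.
Proof.
move=> sg e0; have [mg _] := sg.
(* The bound 4 |a|^2 for the increment of a = g - phi turns e / 16 into e / 4, and the final
   splitting doubles two terms of size e / 4. *)
have e80 : 0 < e / 16 by rewrite divr_gt0.
have [phi bphi Hphi] := bump_dense sg e80.
have sphi := bump_square_integrable bphi.
have [L L0 phiL] := bump_alg_lipschitz bphi.1.
have [r phir] := bphi.2.
(* For |z| <= 1 both phi and phi(. + z) vanish off [B], so the Lipschitz bound only costs the volume
   [V] of [B]. *)
pose B : set 'rV[R]_n := [set x | `|x| <= r + 1].
pose V := sqnorm leb (fun x : 'rV[R]_n => \1_B x).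
have sB : square_integrable leb (fun x : 'rV[R]_n => \1_B x : R).
  exact: square_integrable_indic_norm_le.
have V0 : 0 <= V by exact: sqnorm_ge0.
pose del := Num.min 1 (e / (4 * (L ^+ 2 * V + 1))).
have LV0 : 0 <= L ^+ 2 * V by rewrite mulr_ge0// sqr_ge0.
have c0 : 0 < 4 * (L ^+ 2 * V + 1) by rewrite mulr_gt0// ltr_wpDl.
exists del => [|z]; first by rewrite lt_min ltr01 divr_gt0.
rewrite le_min => /andP[z1 ze].
pose a x := g x - phi x.
have sa : square_integrable leb a by exact: square_integrableB.
have saz := square_integrable_shift z sa.
have sphiz := square_integrable_shift z sphi.
have sdphi := square_integrableB sphiz sphi.
rewrite (_ : (fun x => _) = fun x => (a (x + z) - a x) + (phi (x + z) - phi x));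
  last first.
  by apply/funext => x; rewrite /a; ring.
rewrite (le_trans (sqnormD_le (square_integrableB saz sa) _))//.
have H1 : sqnorm leb (fun x => a (x + z) - a x) <= e / 4.
  have sNa := square_integrableZ (-1) sa.
  rewrite (_ : (fun x => _) = fun x => a (x + z) + (-1) * a x); last first.
    by apply/funext => x; rewrite mulN1r.
  rewrite (le_trans (sqnormD_le saz sNa))// sqnormZ// (sqnorm_shift _ sa.1).
  by rewrite sqrrN expr1n; move: Hphi; rewrite -/a; lra.
suff H2 : sqnorm leb (fun x => phi (x + z) - phi x) <= e / 4 by lra.
have H3 : sqnorm leb (fun x => phi (x + z) - phi x) <= (L * `|z|) ^+ 2 * V.
  rewrite -sqnormZ//; apply: le_Rintegral => //; first by case: sdphi.
    by case: (square_integrableZ (L * `|z|) sB).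
  move=> x _; rewrite -(real_normK (num_real (_ - _))) exprMn indicE.
  have [xB|xB] := boolP (x \in B).
    by rewrite expr1n mulr1 lerXn2r ?nnegrE ?mulr_ge0.
  have out y : r < `|y| -> phi y = 0.
    by move=> ry; apply/eqP; apply: contraTT ry => /phir; rewrite -leNgt.
  have {}xB : r + 1 < `|x| by rewrite ltNge; apply: contra xB; rewrite inE.
  rewrite !out ?subr0 ?normr0 ?expr0n ?mulr0//; first by lra.
  have := ler_normB (x + z) z; rewrite addrK; lra.
rewrite (le_trans H3)// exprMn -mulrA mulrCA.
have z2 : `|z| ^+ 2 <= `|z| by rewrite expr2 ler_piMl.
rewrite (@le_trans _ _ (`|z| * (L ^+ 2 * V + 1)))//.
  by rewrite ler_pM ?sqr_ge0// lerDl.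
rewrite (le_trans (ler_wpM2r _ ze)) ?addr_ge0//.
by rewrite le_eqVlt; apply/orP; left; apply/eqP; field; rewrite gt_eqF// ltr_wpDl.
Qed.

End translation_continuity.

(** * First-order estimate in L2 and weak gradients *)

Section key_estimate.
Context {R : realType} {n : nat}.
Implicit Types (f g u phi : 'rV[R]_n -> R) (x z : 'rV[R]_n).
Local Notation leb := (@lebesgue_rV R n).

Lemma partial_shift i f z : partial i (fun x => f (x + z)) = fun x =>
    partial i f (x + z).
Proof.
apply/funext => x; rewrite /partial /derive.
suff -> : (fun h : R => h^-1 *: (((fun x => f (x + z)) \o shift x) (h *:
    delta_mx 0 i) - f (x + z))) =
    (fun h : R => h^-1 *: ((f \o shift (x + z)) (h *:
      delta_mx 0 i) - f (x + z))) by [].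
by apply/funext => h /=; rewrite addrA.
Qed.

Lemma bump_partial i f : bump f -> bump (partial i f).
Proof.
move=> [bf [r fr]]; split; first exact: bump_alg_partial.
exists r => x; apply: contraNT; rewrite -ltNge => rx.
rewrite /partial; have cst0 : is_derive x (delta_mx 0 i) (fun=> 0 : R) (0 : R).
  exact: is_derive_cst.
have : is_derive x (delta_mx 0 i) f 0.
  apply: near_eq_is_derive cst0; near=> y; apply/eqP; rewrite eq_sym.
  have : r < `|y| by near: y; apply: (cvgr_gt _ (@norm_continuous _ _ x)).
  by apply: contraTT => /fr; rewrite leNgt.
by move=> [_ ->].
Unshelve. all: by end_near. Qed.

Lemma bump_is_derive f : bump_alg f -> forall x v (t : R),
  is_derive t 1 (fun t : R => f (x + t *: v)) (\sum_i v 0 i * partial i f (x + t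
    *: v)).
Proof.
move=> bf; have [D [_ fD]] := bump_alg_is_derive bf.
move=> x v t; rewrite (_ : \sum_i _ = \sum_i v 0 i * D i (x + t *: v));
  first exact: fD.
by apply: eq_bigr => i _; rewrite (bump_alg_deriveE fD i _).2.
Qed.

Variables (u : 'rV[R]_n -> R) (G : 'rV[R]_n -> 'rV[R]_n).
Hypothesis su : square_integrable leb u.
Hypothesis sG : forall i, square_integrable leb (fun x => G x 0 i).
Hypothesis ibp : forall phi, bump phi -> forall i,
  \int[leb]_x (u x * partial i phi x) = - \int[leb]_x (G x 0 i * phi x).

Lemma square_integrable_dot z : square_integrable leb (fun x => dot z (G x)).
Proof. by apply: square_integrable_sum => i; exact: square_integrableZ. Qed.

(** This is t |-> \int u(x + t z) phi(x) dx. Moving the translation onto the test function makes it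
    differentiable in t, although [u] has no pointwise derivative. *)
Let flow_integral phi z t := \int[leb]_x (u x * phi (x - t *: z)).

(** Differentiation under the integral sign, followed by integration by parts against phi(. - t z).
    The open interval contains [0, 1], so that the flow is continuous up to the end points. *)
Let is_derive_flow phi z (t : R) : bump phi -> t \in `]-1, 2[ ->
  is_derive t 1 (flow_integral phi z) (\int[leb]_x (dot z (G x) * phi (x - t *:
    z))).
Proof.
move=> bphi tI.
have sphi (s : R) : bump (fun x => phi (x - s *: z)) by exact: bump_shift.
have spsi i (s : R) : bump (fun x => partial i phi (x - s *: z)).
  by rewrite -partial_shift; exact: bump_partial.
have dphi x (s : R) : is_derive s 1 (fun s => u x * phi (x - s *: z))
    (u x * \sum_i - z 0 i * partial i phi (x - s *: z)).
  have := bump_is_derive bphi.1 x (- z) s.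
  under [in X in X -> _]eq_fun do rewrite scalerN.
  rewrite scalerN => H.
  apply: is_derive_eq (is_deriveZ (u x) H) _; congr (_ * _).
  by apply: eq_bigr => i _; rewrite mxE.
have [C HC] : exists C : R, forall i x, `|partial i phi x| <= C.
  have /choice[C HC] := fun i => bump_alg_bounded (bump_partial i bphi).1.
  exists (\sum_i `|C i|) => i x; rewrite (le_trans (HC i x))// (bigD1 i)//=.
  by rewrite (le_trans (ler_norm _))// lerDl sumr_ge0.
have [r phir] : exists r : R, forall i x, partial i phi x != 0 -> `|x| <= r.
  have /choice[r Hr] := fun i => (bump_partial i bphi).2.
  exists (\sum_i `|r i|) => i x /Hr/le_trans; apply; rewrite (bigD1 i)//=.
  by rewrite (le_trans (ler_norm _))// lerDl sumr_ge0.
(* Since |s| < 2 on ]-1, 2[, this ball contains the supports of all the translated partial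
   derivatives. *)
pose B : set 'rV[R]_n := [set x | `|x| <= r + 2 * `|z|].
pose M := \sum_i `|z 0 i| * C.
have M0 : 0 <= M.
  by apply: sumr_ge0 => i _; rewrite mulr_ge0// (le_trans (normr_ge0 _) (HC i 0)).
pose Gd x := `|u x| * (M * \1_B x).
have sB : square_integrable leb (fun x : 'rV[R]_n => \1_B x : R).
  exact: square_integrable_indic_norm_le.
have d1E s x : partial1of2 (fun s x => u x * phi (x - s *: z)) s x =
    u x * \sum_i - z 0 i * partial i phi (x - s *: z).
  by rewrite partial1of2E; have [_ ->] := dphi x s.
have Gd_ub (s : R) x : s \in `]-1, 2[ -> `|u x * \sum_i - z 0 i * partial i phi
    (x - s *: z)| <= Gd x.
  rewrite in_itv/= => /andP[s1 s2]; rewrite normrM ler_wpM2l// indicE.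
  have [xB|xB] := boolP (x \in B).
    rewrite mulr1 (le_trans (ler_norm_sum _ _ _))// ler_sum// => i _.
    by rewrite normrM normrN ler_wpM2l.
  rewrite mulr0 big1 ?normr0// => i _.
  have [->|/phir xz] := eqVneq (partial i phi (x - s *: z)) 0;
      first by rewrite mulr0.
  exfalso; move/negP: xB; apply; rewrite inE /B/=.
  rewrite -(subrK (s *: z) x) (le_trans (ler_normD _ _))// lerD//
    normrZ ler_wpM2r//.
  by rewrite ler_norml; lra.
have iGd : rintegrable leb Gd.
  apply: rintegrableM; last exact: square_integrableZ.
  apply: le_square_integrable su => [|x]; last by rewrite normr_id.
  by apply: measurableT_comp => //; case: su.
have intf s : rintegrable leb (fun x => u x * phi (x - s *: z)).
  exact: rintegrableM su (bump_square_integrable (sphi s)).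
have Gd0 x : 0 <= Gd x by rewrite mulr_ge0// mulr_ge0// indicE.
have derf (s : R) x : `]-1, 2[%classic s -> [set: 'rV[R]_n] x ->
    derivable (fun s : R => u x * phi (x - s *: z)) s 1.
  by move=> _ _; have [] := dphi x s.
have Gub (s : R) x : `]-1, 2[%classic s -> [set: 'rV[R]_n] x ->
    `|partial1of2 (fun (s : R) x => u x * phi (x - s *: z)) s x| <= Gd x.
  by move=> sI _; rewrite d1E; exact: Gd_ub.
apply: DeriveDef.
  exact: (derivable_under_integral measurableT tI (fun s _ =>
    intf s) derf Gd0 iGd Gub).
rewrite -derive1E.
rewrite (differentiation_under_integral measurableT tI (fun s _ =>
  intf s) derf Gd0 iGd Gub).
have iupsi i : rintegrable leb (fun x => u x * partial i phi (x - t *: z)).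
  exact: rintegrableM su (bump_square_integrable (spsi i t)).
have iGphi i : rintegrable leb (fun x => G x 0 i * phi (x - t *: z)).
  exact: rintegrableM (sG i) (bump_square_integrable (sphi t)).
transitivity (\int[leb]_x (\sum_i - z 0 i * (u x * partial i phi (x - t *: z)))).
  apply: eq_Rintegral => x _; rewrite d1E mulr_sumr.
  by apply: eq_bigr => i _; rewrite mulrCA.
transitivity (\int[leb]_x (\sum_i z 0 i * (G x 0 i * phi (x - t *: z))));
  last first.
  apply: eq_Rintegral => x _; rewrite /dot mulr_suml.
  by apply: eq_bigr => i _; rewrite mulrA.
rewrite !Rintegral_sum; try by move=> i; exact: rintegrableZ.
apply: eq_bigr => i _.
rewrite (RintegralZl _ measurableT (iupsi i)) (RintegralZl _ measurableT (iGphi i)).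
have := ibp (sphi t) i; rewrite partial_shift => ->.
by rewrite mulrNN.
Qed.

(** The time t depends on [phi]; estimates drawn from this identity therefore have to be uniform in
    t. *)
Lemma flow_mean_value phi z : bump phi -> exists2 t : R, t \in `]0, 1[ &
  \int[leb]_x ((u (x + z) - u x) * phi x) =
  \int[leb]_x (dot z (G (x + t *: z)) * phi x).
Proof.
move=> bphi.
have cflow : {within `[0, 1], continuous (flow_integral phi z)}.
  apply: derivable_within_continuous => t.
  rewrite in_itv/= => /andP[t0 t1].
  have tI : t \in `]-1, 2[ by rewrite in_itv/=; lra.
  by have [] := is_derive_flow z bphi tI.
have dflow (t : R) : t \in `]0, 1[ -> is_derive t 1 (flow_integral phi z)
    (\int[leb]_x (dot z (G x) * phi (x - t *: z))).
  rewrite in_itv/= => /andP[t0 t1].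
  by apply: is_derive_flow => //; rewrite in_itv/=; lra.
have [t tI Ht] := MVT ltr01 dflow cflow; exists t => //.
move: Ht; rewrite subr0 mulr1 /flow_integral.
have bz (s : R) : bump (fun x => phi (x - s *: z)) by exact: bump_shift.
have mbz (s : R) : measurable_fun setT (fun x => phi (x - s *: z)) by case:
    (bump_borel (bz s)).
have mu : measurable_fun setT u by case: su.
have md : measurable_fun setT (fun x => dot z (G x)) by case:
    (square_integrable_dot z).
have -> : \int[leb]_x (u x * phi (x - 1 *: z)) = \int[leb]_x (u (x + z) * phi x).
  rewrite -(Rintegral_shift z (measurable_funM mu (mbz 1))).
  by apply: eq_Rintegral => x _ /=; rewrite scale1r addrK.
have -> : \int[leb]_x (u x * phi (x - 0 *: z)) = \int[leb]_x (u x * phi x).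
  by apply: eq_Rintegral => x _; rewrite scale0r subr0.
have -> : \int[leb]_x (dot z (G x) * phi (x - t *: z)) =
    \int[leb]_x (dot z (G (x + t *: z)) * phi x).
  rewrite -(Rintegral_shift (t *: z) (measurable_funM md (mbz t))).
  by apply: eq_Rintegral => x _ /=; rewrite addrK.
move=> <-.
have sb := bump_square_integrable bphi.
rewrite -RintegralB//.
- by apply: eq_Rintegral => x _; rewrite mulrBl.
- exact: rintegrableM (square_integrable_shift z su) sb.
- exact: rintegrableM su sb.
Qed.

(* For a bump function phi close to w = u(. + z) - u - z . G, the mean value
   theorem for t |-> \int u phi(. - t z) and 2ab <= a^2 + b^2 give
   2 \int w phi <= K + |phi|^2, while 2 \int w phi = |w|^2 + |phi|^2 - |w - phi|^2. *)
Lemma sqnorm_taylor_le z (K : R) :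
  (forall t : R, t \in `]0, 1[ ->
    sqnorm leb (fun x => dot z (G (x + t *: z)) - dot z (G x)) <= K) ->
  sqnorm leb (fun x => u (x + z) - u x - dot z (G x)) <= K.
Proof.
move=> HK; set w := fun x => _.
have sd := square_integrable_dot z.
have sdt t := square_integrable_shift (t *: z) sd.
have suz := square_integrableB (square_integrable_shift z su) su.
have sw : square_integrable leb w by exact: square_integrableB.
apply/ler_addgt0Pr => e e0.
have [phi bphi Hphi] := bump_dense sw e0.
have sphi := bump_square_integrable bphi.
suff : 2 * \int[leb]_x (w x * phi x) <= K + sqnorm leb phi.
  suff : sqnorm leb (fun x => w x - phi x) =
      sqnorm leb w - 2 * \int[leb]_x (w x * phi x) + sqnorm leb phi.
    by move: Hphi; lra.
  have [_ iw] := sw; have [_ iphi] := sphi; have iwp := rintegrableM sw sphi.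
  rewrite /sqnorm -RintegralZl// -RintegralB//; last exact: rintegrableZ.
  rewrite -RintegralD//; last by apply: rintegrableB => //; exact: rintegrableZ.
  by apply: eq_Rintegral => x _; ring.
have [t tI Ht] := flow_mean_value z bphi.
pose v x := dot z (G (x + t *: z)) - dot z (G x).
have sv : square_integrable leb v by apply: square_integrableB.
have -> : \int[leb]_x (w x * phi x) = \int[leb]_x (v x * phi x).
  transitivity (\int[leb]_x ((u (x + z) - u x) * phi x - dot z (G x) * phi x)).
    by apply: eq_Rintegral => x _; rewrite /w mulrBl.
  rewrite RintegralB//; [|exact: rintegrableM..].
  rewrite Ht -RintegralB//; [|exact: rintegrableM..].
  by apply: eq_Rintegral => x _; rewrite /v mulrBl.
have [_ iv] := sv; have [_ iphi] := sphi; have ivp := rintegrableM sv sphi.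
apply: (@le_trans _ _ (sqnorm leb v + sqnorm leb phi)); last by rewrite lerD2r HK.
rewrite /sqnorm -RintegralZl// -RintegralD//; apply: le_Rintegral => //.
- exact: rintegrableZ.
- exact: rintegrableD.
- by move=> x _; have := sqr_ge0 (v x - phi x); nra.
Qed.

End key_estimate.

(** * The du Bois-Reymond lemma *)

Section du_bois_reymond.
Context {R : realType} {n : nat}.
Implicit Types (f phi : 'rV[R]_n -> R) (x : 'rV[R]_n).
Local Notation leb := (@lebesgue_rV R n).

(** By induction [f] is orthogonal to every bounded Borel function of bounded support; testing with
    its sign on the ball of radius k shows that |f| has integral 0 there. *)
Lemma du_bois_reymond f : measurable_fun setT f ->
  (forall r, rintegrable leb (fun x => f x * \1_[set x :
    'rV[R]_n | `|x| <= r] x)) ->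
  (forall phi, bump phi -> \int[leb]_x (f x * phi x) = 0) ->
  exists Z : set 'rV[R]_n, [/\ measurable Z, leb Z = 0%E & forall x, ~ Z x ->
    f x = 0].
Proof.
move=> mf fi fbump.
pose B r : set 'rV[R]_n := [set x | `|x| <= r].
have mB r : measurable (B r) by exact: measurable_norm_le.
have dom (phi : 'rV[R]_n -> R) (C r : R) : (forall x, `|phi x| <= C) ->
    (forall x, phi x != 0 -> `|x| <= r) ->
    forall x, `|f x * phi x| <= `|C| * `|f x * \1_(B r) x|.
  move=> phiC phir x; have [->|/phir xr] := eqVneq (phi x) 0.
    by rewrite mulr0 normr0 mulr_ge0.
  rewrite indicE mem_set// mulr1 normrM mulrC ler_wpM2r//.
  by rewrite (le_trans (phiC x))// ler_norm.
have idom (r C : R) : rintegrable leb (fun x => `|C| * `|f x * \1_(B r) x|).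
  by apply: rintegrableZ; exact: (integrable_norm (fi r)).
have fphi (phi : 'rV[R]_n -> R) : measurable_fun setT phi -> (exists C : R,
    forall x, `|phi x| <= C) ->
    bounded_support phi -> rintegrable leb (fun x => f x * phi x).
  move=> mphi [C phiC] [r phir].
  by apply: (le_rintegrable _ (dom _ _ _ phiC phir) (idom r C)); exact:
    measurable_funM.
pose K phi := [/\ measurable_fun setT phi, exists C : R, forall x, `|phi x| <= C,
  bounded_support phi & \int[leb]_x (f x * phi x) = 0].
have Kall phi : measurable_fun setT phi -> (exists C : R, forall x,
    `|phi x| <= C) ->
    bounded_support phi -> K phi.
  apply: bounded_borel_ind => {phi}.
  - by move=> phi bphi; have [? ? ?] := bump_borel bphi; split => //; exact: fbump.
  - move=> a phi psi [m1 [C1 b1] [r1 s1] i1] [m2 [C2 b2] [r2 s2] i2].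
    have f1 : rintegrable leb (fun x => f x * phi x) by apply: fphi => //;
        [exists C1|exists r1].
    have f2 : rintegrable leb (fun x => f x * psi x) by apply: fphi => //;
        [exists C2|exists r2].
    split.
    + by apply: measurable_funD => //; exact: measurable_funM.
    + exists (`|a| * C1 + C2) => x; rewrite (le_trans (ler_normD _ _))// lerD//.
      by rewrite normrM ler_wpM2l.
    + exists (Num.max r1 r2) => x; rewrite le_max.
      have [->|/s1 ->//] := eqVneq (phi x) 0.
      by rewrite mulr0 add0r => /s2 ->; rewrite orbT.
    + transitivity (\int[leb]_x (a * (f x * phi x) + f x * psi x)).
        by apply: eq_Rintegral => x _; ring.
      rewrite RintegralD//; last exact: rintegrableZ.
      by rewrite (RintegralZl _ measurableT f1) i1 i2 mulr0 addr0.
  - move=> F phi C r KF FC Fr Fphi.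
    have mphi : measurable_fun setT phi.
      by apply: (@measurable_fun_cvg _ _ _ _ F) => [k|x _]; [case: (KF k)|exact:
        Fphi].
    split => //.
    + exists C => x; apply: (cvgr_to_le (cvg_norm (Fphi x))).
      by apply: nearW => k; exact: FC.
    + exists r => x; apply: contraNT; rewrite -ltNge => rx.
      rewrite -(cvg_lim (@Rhausdorff R) (Fphi x)).
      rewrite (_ : (fun k => F k x) = fun=> 0) ?lim_cst//.
      by apply/funext => k; apply/eqP; apply: contraTT rx => /Fr; rewrite -leNgt.
    + have [|x|k x|_] := @rintegrable_dominated _ _ _ leb (fun k x => f x * F k x)
        (fun x => f x * phi x) (fun x => `|C| * `|f x * \1_(B r) x|) _ _ _ (idom
          r C).
      * by move=> k; apply: measurable_funM => //; case: (KF k).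
      * by apply: cvgM; [exact: cvg_cst|exact: Fphi].
      * exact: (dom _ _ _ (FC k) (Fr k)).
      * rewrite (_ : (fun k => _) = fun=> 0); last by apply/funext => k; case:
        (KF k).
        by move=> /(cvg_lim (@Rhausdorff R)); rewrite lim_cst.
have fk0 k : ae_eq leb setT (fun x => (f x * \1_(B k%:R) x)%:E) (cst 0%E).
  apply/ae_eq_integral_abs => //.
    by apply/measurable_EFinP; apply: measurable_funM => //; exact:
      measurable_indic.
  pose P : set 'rV[R]_n := f @^-1` `[0, +oo[.
  have mP : measurable P by rewrite -[P]setTI; exact: mf.
  (* 2 1_P - 1 is the sign of [f], with the value 1 at the zeros. *)
  pose psi x : R := (2 * \1_P x - 1) * \1_(B k%:R) x.
  have mpsi : measurable_fun setT psi.
    apply: measurable_funM; last exact: measurable_indic.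
    by apply: measurable_funB => //; apply: measurable_funM => //; exact:
      measurable_indic.
  have bpsi : exists C : R, forall x, `|psi x| <= C.
    exists 1 => x; rewrite normrM -[leRHS]mulr1 ler_pM// indicE.
      by case: (_ \in _); rewrite ler_norml /=; lra.
    by case: (_ \in _); rewrite ?normr0 ?normr1.
  have spsi : bounded_support psi.
    exists k%:R => x; rewrite /psi mulrC [\1_(B _) x]indicE.
    case: (boolP (x \in B _)); first by rewrite inE.
    by rewrite mul0r eqxx.
  have [_ _ _ K0] := Kall psi mpsi bpsi spsi.
  transitivity (\int[leb]_x (f x * psi x))%:E; last by rewrite K0.
  rewrite -EFin_rintegral; last first.
    exact: fphi.
  apply: eq_integral => x _; congr EFin.
  rewrite normrM [`|\1_(B _) x|]ger0_norm ?indicE// [RHS]mulrA; congr (_ * _).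
  rewrite indicE; have [fP|fP] := boolP (x \in P) => /=.
    by move: fP; rewrite inE /P/= in_itv/= andbT => /ger0_norm ->; ring.
  have : f x < 0 by rewrite ltNge; apply: contra fP;
      rewrite inE /P/= in_itv/= andbT.
  by move=> /ltr0_norm ->; ring.
have /ae_foralln[Z [mZ Z0 HZ]] := fk0.
exists Z; split => // x Zx; apply: contrapT => fx0; apply: Zx; apply: HZ => /= H.
have [k xk] : exists k : nat, `|x| <= k%:R.
  by have [k _ Hk] := nbhs_infty_ger `|x|; exists k; exact: Hk (leqnn k).
have [] := H k I; rewrite indicE mem_set// mulr1.
exact: fx0.
Qed.
End du_bois_reymond.

(** * Borel representatives of H1 functions and of their gradients *)

Section representatives.
Context {R : realType} {n : nat}.
Implicit Types (f u phi : 'rV[R]_n -> R) (x : 'rV[R]_n).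
Local Notation leb := (@lebesgue_rV R n).

Definition null_set (Z : set 'rV[R]_n) := measurable Z /\ leb Z = 0%E.

Lemma null_setU Y Z : null_set Y -> null_set Z -> null_set (Y `|` Z).
Proof.
move=> [mY Y0] [mZ Z0]; split; first exact: measurableU.
by rewrite null_set_setU.
Qed.

Lemma null_set_bigcup (Z : 'I_n -> set 'rV[R]_n) : (forall i, null_set (Z i)) ->
  null_set (\bigcup_i Z i).
Proof.
move=> HZ; have mU : measurable (\bigcup_i Z i).
  by apply: fin_bigcup_measurable => [|i _]; [exact: finite_finset|exact: (HZ i).1].
split=> //; apply/negligibleP => //.
rewrite (_ : \bigcup_i Z i = \bigcup_k (if @insub _ (fun k =>
  (k < n)%N) 'I_n k is Some i then Z i else set0)).
  apply: negligible_bigcup => k; case: insubP => [i _ _|_]; last exact: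
    negligible_set0.
  by apply/negligibleP; case: (HZ i).
apply/seteqP; split => [x [i _ Zix]|x [k _]].
  by exists i => //; rewrite valK.
by case: insubP => // i _ _ Zix; exists i.
Qed.

Lemma restrict_off (Z : set 'rV[R]_n) f x : ~ Z x -> f x = (f \_ (~` Z)) x.
Proof. by move=> Zx; rewrite patchT// inE. Qed.

Lemma rintegral_off_null (Z : set 'rV[R]_n) f g : null_set Z ->
  (forall x, ~ Z x -> f x = g x) -> \int[leb]_x f x = \int[leb]_x g x.
Proof.
move=> [mZ Z0] fg; congr fine; apply: (eq_integral_off_null mZ Z0).
by move=> x /fg ->.
Qed.

Lemma L2_borel f : L2 f -> exists Z, null_set Z /\ square_integrable leb (f \_
    (~` Z)).
Proof.
have n2 : 2^-1 != 0 :> R by rewrite invr_eq0 pnatr_eq0.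
move=> [mf]; rewrite /finite_norm unlock => /(lty_poweRy n2) fi.
have [Z [mZ Z0 mfZ]] := lebesgue_measurable_borel mf.
exists Z; split => //; split => //; apply: rintegrableP.
- exact: measurable_funX.
- by move=> x; exact: sqr_ge0.
- rewrite -(@eq_integral_off_null _ _ _ leb Z mZ Z0 _ (fun x =>
  `|(EFin \o f) x| `^ 2)%E)// => x Zx.
  by rewrite -restrict_off//= powR_mulrn// real_normK// num_real.
Qed.

Definition rintegrable_loc f := measurable_fun setT f /\
  forall r : R, rintegrable leb (fun x => f x * \1_[set x :
    'rV[R]_n | `|x| <= r] x).

Lemma rintegrable_locM f phi : rintegrable_loc f -> bump phi ->
  rintegrable leb (fun x => f x * phi x).
Proof.
move=> [mf fi] bphi; have [mphi [C phiC] [r phir]] := bump_borel bphi.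
have : rintegrable leb (fun x => `|C| * `|f x * \1_[set x :
    'rV[R]_n | `|x| <= r] x|).
  by apply: rintegrableZ; exact: (integrable_norm (fi r)).
apply: le_rintegrable; first exact: measurable_funM.
move=> x; have [->|/phir xr] := eqVneq (phi x) 0.
  by rewrite mulr0 normr0 mulr_ge0.
rewrite indicE mem_set// mulr1 normrM mulrC ler_wpM2r//.
by rewrite (le_trans (phiC x))// ler_norm.
Qed.

Lemma L1loc_borel f : L1loc f -> exists Z, null_set Z /\ rintegrable_loc (f \_
    (~` Z)).
Proof.
move=> [mf fi]; have [Z [mZ Z0 mfZ]] := lebesgue_measurable_borel mf.
exists Z; split => //; split => // r.
have mB := @measurable_norm_le R n r.
apply/integrableP; split.
  by apply/measurable_EFinP; apply: measurable_funM => //; exact: measurable_indic.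
apply: (le_lt_trans _ (fi _ (@compact_norm_le R n r))).
rewrite [leRHS]integral_mkcond le_eqVlt; apply/orP; left; apply/eqP.
apply: (eq_integral_off_null mZ Z0) => x Zx.
rewrite /= -(restrict_off f Zx) patchE indicE; case: ifPn => _;
  first by rewrite mulr1.
by rewrite mulr0 normr0.
Qed.

Lemma square_integrable_loc f : square_integrable leb f -> rintegrable_loc f.
Proof.
move=> sf; split; first by case: sf.
by move=> r; apply: rintegrableM => //; exact: square_integrable_indic_norm_le.
Qed.

Lemma weak_gradient_ibp (Z : set 'rV[R]_n) u u' (g g' : 'rV[R]_n -> 'rV[R]_n) :
  null_set Z -> (forall x, ~ Z x -> u x = u' x) -> (forall x, ~ Z x -> forall i,
    g x 0 i = g' x 0 i) ->
  weak_gradient u g -> forall phi, bump phi -> forall i,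
  \int[leb]_x (u' x * partial i phi x) = - \int[leb]_x (g' x 0 i * phi x).
Proof.
move=> nZ uu gg [_ _ wg] phi bphi i.
have := congr1 fine (wg phi (bump_test_function bphi) i); rewrite fineN.
rewrite -!/(Rintegral _ _ _).
rewrite (@rintegral_off_null Z (fun x => u x * _) (fun x =>
  u' x * partial i phi x) nZ); last first.
  by move=> x /uu ->.
rewrite (@rintegral_off_null Z (fun x => g x 0 i * _) (fun x =>
  g' x 0 i * phi x) nZ)//.
by move=> x /gg ->.
Qed.

(** [H1] only provides some square integrable gradient [g], while [Du] is a priori another weak
    gradient, merely locally integrable. The du Bois-Reymond lemma shows that they agree almost
    everywhere, so that [G], built from [g], represents both. *)
Lemma H1_borel u (Du : 'rV[R]_n -> 'rV[R]_n) : H1 u -> weak_gradient u Du ->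
  exists Z u' (G : 'rV[R]_n -> 'rV[R]_n), [/\ null_set Z,
    square_integrable leb u', forall i, square_integrable leb (fun x => G x 0 i),
    forall phi, bump phi -> forall i,
      \int[leb]_x (u' x * partial i phi x) = - \int[leb]_x (G x 0 i * phi x) &
    forall x, ~ Z x -> u x = u' x /\ Du x = G x].
Proof.
move=> [/L2_borel[Zu [nZu su]] [g wg L2g]] wD.
have /choice[Zg HZg] := fun i => L2_borel (L2g i).
have [_ L1D _] := wD.
have /choice[ZD HZD] := fun i => L1loc_borel (L1D i).
pose u' := u \_ (~` Zu).
pose g' i := (fun x => g x 0 i) \_ (~` Zg i).
pose D' i := (fun x => Du x 0 i) \_ (~` ZD i).
pose G x : 'rV[R]_n := \row_i g' i x.
pose Z1 := Zu `|` (\bigcup_i Zg i `|` \bigcup_i ZD i).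
have nZ1 : null_set Z1.
  apply: null_setU => //; apply: null_setU; apply: null_set_bigcup => i.
    exact: (HZg i).1.
  exact: (HZD i).1.
have uu x : ~ Z1 x -> u x = u' x.
  by move=> Zx; rewrite /u' -restrict_off// => ?; apply: Zx; left.
have gG x : ~ Z1 x -> forall i, g x 0 i = G x 0 i.
  move=> Zx i; rewrite mxE /g' -restrict_off// => ?; apply: Zx; right; left.
  by exists i.
have DD x : ~ Z1 x -> forall i, Du x 0 i = (\row_i D' i x : 'rV[R]_n) 0 i.
  move=> Zx i; rewrite mxE /D' -restrict_off// => ?; apply: Zx; right; right.
  by exists i.
have ibpG := weak_gradient_ibp nZ1 uu gG wg.
have ibpD := weak_gradient_ibp nZ1 uu DD wD.
have sG i : square_integrable leb (fun x => G x 0 i).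
  by under eq_fun do rewrite mxE; exact: (HZg i).2.
have /choice[Z2 HZ2] i : exists Z, null_set Z /\ forall x, ~ Z x ->
    D' i x - G x 0 i = 0.
  have lD : rintegrable_loc (D' i) by exact: (HZD i).2.
  have lG : rintegrable_loc (fun x => G x 0 i) by exact: square_integrable_loc.
  have [|r|phi bphi|Z [mZ Z0 HZ]] := @du_bois_reymond R n (fun x =>
      D' i x - G x 0 i).
  - by apply: measurable_funB; [case: lD|case: lG].
  - under eq_fun do rewrite mulrBl.
    by apply: rintegrableB; [exact: lD.2|exact: lG.2].
  - under eq_Rintegral do rewrite mulrBl.
    rewrite RintegralB//; [|exact: rintegrable_locM..].
    have := ibpD _ bphi i; under [X in _ = - X -> _]eq_Rintegral do rewrite mxE.
    by move=> E; apply/eqP; rewrite subr_eq0 -eqr_opp -E ibpG.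
  - by exists Z.
exists (Z1 `|` \bigcup_i Z2 i), u', G; split => //.
  apply: null_setU => //; apply: null_set_bigcup => i; exact: (HZ2 i).1.
move=> x Zx; split; first by apply: uu => ?; apply: Zx; left.
apply/rowP => i; rewrite DD; last by move=> ?; apply: Zx; left.
rewrite [in LHS]mxE; apply/eqP; rewrite -subr_eq0; apply/eqP.
by apply: (HZ2 i).2 => ?; apply: Zx; right; exists i.
Qed.

End representatives.

(** * Nonlocal energy and second moments of kernels *)

Section dot_enorm.
Context {R : realType} {n : nat}.
Implicit Types x y z : 'rV[R]_n.

Lemma dot_ge0 x : 0 <= dot x x.
Proof. by apply: sumr_ge0 => i _; rewrite -expr2 sqr_ge0. Qed.

Lemma sqr_enorm x : enorm x ^+ 2 = dot x x.
Proof. by rewrite sqr_sqrtr// dot_ge0. Qed.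

Lemma coord_sqr_le_dot x i : x 0 i ^+ 2 <= dot x x.
Proof.
rewrite /dot (bigD1 i)//= -expr2 lerDl; apply: sumr_ge0 => j _.
by rewrite -expr2 sqr_ge0.
Qed.

Lemma dotZl c x y : dot (c *: x) y = c * dot x y.
Proof. by rewrite /dot mulr_sumr; apply: eq_bigr => i _; rewrite mxE mulrA. Qed.

Lemma dotZr c (x y : 'rV[R]_n) : dot x (c *: y) = c * dot x y.
Proof. by rewrite /dot mulr_sumr; apply: eq_bigr => i _; rewrite mxE mulrCA. Qed.

Lemma dotBr x y z : dot x (y - z) = dot x y - dot x z.
Proof. by rewrite /dot -sumrB; apply: eq_bigr => i _; rewrite !mxE mulrBr. Qed.

Lemma norm_le_enorm x : `|x| <= enorm x.
Proof.
apply: norm_le_coord => [|i]; first exact: sqrtr_ge0.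
by rewrite -sqrtr_sqr ler_wsqrtr// coord_sqr_le_dot.
Qed.

Lemma measurable_dot d (T : measurableType d) (f g : T -> 'rV[R]_n) :
  measurable_fun setT f -> measurable_fun setT g ->
  measurable_fun setT (fun t => dot (f t) (g t)).
Proof.
move=> mf mg; apply: measurable_sum => i.
by apply: measurable_funM; exact: (measurableT_comp (measurable_coord i)).
Qed.

Lemma measurable_dotV : measurable_fun setT (fun x => (dot x x)^-1).
Proof.
under eq_fun do rewrite -powR_inv1 ?dot_ge0//.
apply: (measurableT_comp (measurable_powR (-1))).
by apply: measurable_dot; exact: measurable_id.
Qed.

Lemma measurable_enorm : measurable_fun setT (@enorm R n).
Proof.
rewrite (_ : enorm = fun x => (dot x x) `^ 2^-1); last first.
  by apply/funext => x; rewrite powR12_sqrt// dot_ge0.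
apply: (measurableT_comp (measurable_powR 2^-1)).
by apply: measurable_dot; exact: measurable_id.
Qed.

Lemma measurable_eball r : measurable (@eball R n r).
Proof.
have := @measurable_enorm measurableT _ (measurable_itv `]-oo, r[).
by rewrite setTI; congr (measurable _).
Qed.

Lemma measurable_unit_sphere : measurable (@unit_sphere R n).
Proof.
have := @measurable_enorm measurableT _ (measurable_set1 1).
by rewrite setTI; congr (measurable _).
Qed.

End dot_enorm.

Section nonlocal_energy.
Context {R : realType} {n : nat}.
Local Notation leb := (@lebesgue_rV R n).
Local Open Scope ereal_scope.

Lemma measurable_subp : measurable_fun setT (fun p : 'rV[R]_n * 'rV[R]_n =>
    (p.2 - p.1)%R).
Proof.
apply: measurable_fun_rV => i; under eq_fun do rewrite !mxE.
by apply: measurable_funB; apply: (measurableT_comp (measurable_coord i)).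
Qed.

Lemma measurable_addp : measurable_fun setT (fun p : 'rV[R]_n * 'rV[R]_n =>
    (p.1 + p.2)%R).
Proof.
apply: measurable_fun_rV => i; under eq_fun do rewrite !mxE.
by apply: measurable_funD; apply: (measurableT_comp (measurable_coord i)).
Qed.

Lemma product_null_set (Y Z : set 'rV[R]_n) : null_set Y -> null_set Z ->
  exists W, [/\ measurable W, (leb \x leb) W = 0 &
    forall p, ~ W p -> [/\ ~ Y (p.2 - p.1)%R, ~ Z p.1 & ~ Z p.2]].
Proof.
move=> [mY Y0] [mZ Z0].
pose W1 := (fun p : 'rV[R]_n * 'rV[R]_n => (p.2 - p.1)%R) @^-1` Y.
have mW1 : measurable W1 by rewrite -[W1]setTI; exact: measurable_subp.
(* Each section of [W1] at fixed p.1 is a translate of [Y], hence null. *)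
have W10 : (leb \x leb) W1 = 0.
  rewrite -[W1]setIT -integral_indic// fubini_tonelli1/=; last 2 first.
    by apply/measurable_EFinP; exact: measurable_indic.
    by move=> x; rewrite lee_fin indicE.
  rewrite integral0_eq// => x _.
  have mY1 : measurable_fun setT (fun z : 'rV[R]_n => (\1_Y z)%:E : \bar R).
    by apply/measurable_EFinP; exact: measurable_indic.
  rewrite (_ : fubini_F _ _ _ = \int[leb]_y (\1_Y (y + - x)%R)%:E)//.
  by rewrite (ge0_integral_shift (- x) mY1)// integral_indic// setIT.
have m2 : measurable (Z `*` [set: 'rV[R]_n]) by exact: measurableX.
have m3 : measurable ([set: 'rV[R]_n] `*` Z) by exact: measurableX.
have W20 : (leb \x leb) (Z `*` setT) = 0.
  by transitivity (leb Z * leb setT); [exact: product_measure1E|rewrite Z0 mul0e].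
have W30 : (leb \x leb) (setT `*` Z) = 0.
  by transitivity (leb setT * leb Z); [exact: product_measure1E|rewrite Z0 mule0].
have m23 := measurableU _ _ m2 m3.
exists (W1 `|` (Z `*` setT `|` setT `*` Z)); split.
- exact: measurableU.
- by rewrite null_set_setU// null_set_setU.
- move=> p Wp; split=> H; apply: Wp; [by left|by right; left|by right; right].
Qed.

(** Tonelli needs a Borel integrand, so the representatives are put in place first, off a null set
    of the product. It is then applied twice: to shift y by x in the inner integral, and to
    integrate in x first. *)
Lemma nonlocal_energyE (rho rho' : 'rV[R]_n -> R) (u u' : 'rV[R]_n -> R) (Y Z :
    set 'rV[R]_n) :
  null_set Y -> null_set Z -> (forall z, ~ Y z -> rho z = rho' z) -> (forall z,
    ~ Z z -> u z = u' z) ->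
  (forall z, 0 <= rho' z)%R -> measurable_fun setT rho' ->
    square_integrable leb u' ->
  nonlocal_energy rho u =
  (2^-1)%:E * \int[leb]_z (rho' z * (sqnorm leb (fun x => u' (x + z) - u' x)%R /
    enorm z ^+ 2))%:E.
Proof.
move=> nY nZ rr uu r0 mr su.
have [mu' _] := su.
have [W [mW W0 HW]] := product_null_set nY nZ.
congr (_ * _).
pose F (p : 'rV[R]_n * 'rV[R]_n) : R := (rho' (p.2 - p.1) * ((u' p.2 - u' p.1)
  ^+ 2 / dot (p.2 - p.1) (p.2 - p.1)))%R.
have F0 p : (0 <= F p)%R by rewrite mulr_ge0// mulr_ge0 ?sqr_ge0// invr_ge0 dot_ge0.
have mF : measurable_fun setT F.
  apply: measurable_funM; first exact: measurableT_comp mr measurable_subp.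
  apply: measurable_funM; last exact: (measurableT_comp measurable_dotV
    measurable_subp).
  by apply: measurable_funX; apply: measurable_funB; apply: measurableT_comp mu' _.
transitivity (\int[leb \x leb]_p (F p)%:E).
  apply: (eq_integral_off_null mW W0) => p /HW[Yp Z1 Z2].
  by rewrite rr// !uu// sqr_enorm real_normK// num_real.
rewrite fubini_tonelli1/=; [|exact/measurable_EFinP|by move=> p; rewrite lee_fin].
pose H (p : 'rV[R]_n * 'rV[R]_n) := (F (p.1, (p.1 + p.2)%R))%:E.
have mH : measurable_fun setT H.
  apply/measurable_EFinP; apply: (measurableT_comp mF).
  by apply: measurable_fun_pair => //; exact: measurable_addp.
transitivity (\int[leb]_x \int[leb]_z H (x, z)).
  apply: eq_integral => x _; rewrite /fubini_F.
  have mFx : measurable_fun setT (fun y => (F (x, y))%:E).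
    by apply/measurable_EFinP; exact: (measurableT_comp mF (pair1_measurable x)).
  rewrite -(ge0_integral_shift x mFx) => [|y]; last by rewrite lee_fin.
  by apply: eq_integral => z _; rewrite /H/= addrC.
rewrite fubini_tonelli//; last by move=> p; rewrite lee_fin.
apply: eq_integral => z _.
have su2 := square_integrableB (square_integrable_shift z su) su.
rewrite sqr_enorm.
transitivity (\int[leb]_x ((rho' z / dot z z)%:E * ((u' (x + z) - u' x) ^+ 2)%:E)).
  apply: eq_integral => x _; rewrite /H /F/= -EFinM [(x + z - x)%R]addrC addKr.
  by congr EFin; ring.
rewrite ge0_integralZl_EFin//.
- rewrite (EFin_rintegral su2.2) -EFinM; congr EFin; rewrite /sqnorm; ring.
- by move=> x _; rewrite lee_fin sqr_ge0.
- by apply/measurable_EFinP; apply: measurable_funX; case: su2.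
- by rewrite divr_ge0// dot_ge0.
Qed.

End nonlocal_energy.

(** * Expansion of the squared L2 norm of small increments *)

Section small_increments.
Context {R : realType} {n : nat}.
Implicit Types (x y z : 'rV[R]_n).
Local Notation leb := (@lebesgue_rV R n).

Lemma dot_cauchy_schwarz y z : dot z y ^+ 2 <= dot z z * dot y y.
Proof.
have dotE (a b : R) : dot (a *: y + b *: z) (a *: y + b *: z) =
    a ^+ 2 * dot y y + 2 * a * b * dot z y + b ^+ 2 * dot z z.
  rewrite /dot !mulr_sumr -!big_split/=; apply: eq_bigr => i _; rewrite !mxE; ring.
have zz0 := dot_ge0 z; have yy0 := dot_ge0 y.
have := dot_ge0 (dot z z *: y + (- dot z y) *: z); rewrite dotE => H.
have [z0|z0] := eqVneq (dot z z) 0; last first.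
  have zp : 0 < dot z z by rewrite lt_def z0.
  rewrite -(ler_pM2l zp); nra.
(* When dot z z = 0, the square of this vector is - (dot z y)^2 (dot y y + 2), which forces dot z y
   = 0. *)
have := dot_ge0 (dot z y *: y + (- (dot y y + 1)) *: z);
    rewrite dotE z0 mul0r mulr0 addr0.
nra.
Qed.

Variables (u : 'rV[R]_n -> R) (G : 'rV[R]_n -> 'rV[R]_n).
Hypothesis su : square_integrable leb u.
Hypothesis sG : forall i, square_integrable leb (fun x => G x 0 i).
Hypothesis ibp : forall phi, bump phi -> forall i,
  \int[leb]_x (u x * partial i phi x) = - \int[leb]_x (G x 0 i * phi x).

Let D z := sqnorm leb (fun x => u (x + z) - u x).
Let A z := sqnorm leb (fun x => dot z (G x)).

Lemma sqnorm_dot_le (H : 'rV[R]_n -> 'rV[R]_n) z :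
  (forall i, square_integrable leb (fun x => H x 0 i)) ->
  sqnorm leb (fun x => dot z (H x)) <= dot z z * \sum_i sqnorm leb (fun x =>
    H x 0 i).
Proof.
move=> sH; have iH i : rintegrable leb (fun x => H x 0 i ^+ 2) by case: (sH i).
have sD : square_integrable leb (fun x => dot z (H x)).
  by apply: square_integrable_sum => i; exact: square_integrableZ.
rewrite /sqnorm -Rintegral_sum// -RintegralZl//; last exact: rintegrable_sum.
apply: le_Rintegral => //; first by case: sD.
  by apply: rintegrableZ; exact: rintegrable_sum.
by move=> x _; rewrite (le_trans (dot_cauchy_schwarz _ _))// ler_wpM2l ?dot_ge0.
Qed.

Lemma sqnorm_increment_le z : D z <= 4 * sqnorm leb u.
Proof.
have sNu := square_integrableZ (-1) su.
rewrite /D (_ : (fun x => _) = fun x => u (x + z) + (-1) * u x); last first.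
  by apply/funext => x; rewrite mulN1r.
rewrite (le_trans (sqnormD_le (square_integrable_shift z su) sNu))//.
by rewrite sqnormZ// (sqnorm_shift _ su.1) sqrrN expr1n; lra.
Qed.

(** Young's inequality 2 |b w| <= t b^2 + w^2 / t. The weight t is left free: it is fixed first, and
    [w] is then taken small compared with it. *)
Lemma sqnormD_sub_le (b w : 'rV[R]_n -> R) t : 0 < t ->
  square_integrable leb b -> square_integrable leb w ->
  `|sqnorm leb (fun x => b x + w x) - sqnorm leb b| <= t * sqnorm leb b + (1 +
    t^-1) * sqnorm leb w.
Proof.
move=> t0 sb sw; have [_ ib] := sb; have [_ iw] := sw;
  have ibw := rintegrableM sb sw.
have -> : sqnorm leb (fun x => b x + w x) =
    sqnorm leb b + 2 * \int[leb]_x (b x * w x) + sqnorm leb w.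
  rewrite /sqnorm -RintegralZl// -RintegralD//; last exact: rintegrableZ.
  rewrite -RintegralD//; last by apply: rintegrableD => //; exact: rintegrableZ.
  by apply: eq_Rintegral => x _; ring.
suff : `|2 * \int[leb]_x (b x * w x)| <= t * sqnorm leb b + t^-1 * sqnorm leb w.
  have := sqnorm_ge0 leb w; rewrite !ler_norml; nra.
rewrite -RintegralZl//; apply: le_trans (le_normr_Rintegral _ _) _ => //;
  first exact: rintegrableZ.
rewrite /sqnorm -!RintegralZl// -RintegralD//; [|exact: rintegrableZ..].
apply: le_Rintegral => //.
- exact: (integrable_norm (rintegrableZ 2 ibw)).
- by apply: rintegrableD; exact: rintegrableZ.
- move=> x _.
  have H1 : 0 <= t^-1 * (t * b x - w x) ^+ 2 by rewrite mulr_ge0 ?sqr_ge0//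
      invr_ge0 ltW.
  have H2 : 0 <= t^-1 * (t * b x + w x) ^+ 2 by rewrite mulr_ge0 ?sqr_ge0//
      invr_ge0 ltW.
  have E1 : t^-1 * (t * b x - w x) ^+ 2 = t * b x ^+ 2 + t^-1 * w x ^+ 2 - 2 *
      (b x * w x).
    by field; rewrite gt_eqF.
  have E2 : t^-1 * (t * b x + w x) ^+ 2 = t * b x ^+ 2 + t^-1 * w x ^+ 2 + 2 *
      (b x * w x).
    by field; rewrite gt_eqF.
  by rewrite ler_norml; move: H1 H2; rewrite E1 E2; lra.
Qed.

(** By [sqnorm_taylor_le] the remainder is controlled by the increments of [G] under the
    translations by t z with 0 < t < 1, which are small by continuity of translations in L2. *)
Lemma sqnorm_taylor_small (kappa : R) : 0 < kappa -> exists2 del, 0 < del &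
  forall z, `|z| <= del ->
    sqnorm leb (fun x => u (x + z) - u x - dot z (G x)) <= kappa * dot z z.
Proof.
(* n.+1 instead of n, and the default value 1 of the minimum below, cover n = 0. *)
move=> k0; have kn0 : 0 < kappa / n.+1%:R by rewrite divr_gt0.
have /choice[del Hdel] i : exists del : R, 0 < del /\ forall z, `|z| <= del ->
    sqnorm leb (fun x => G (x + z) 0 i - G x 0 i) <= kappa / n.+1%:R.
  by have [del d0 Hd] := translation_continuous_L2 (sG i) kn0; exists del.
exists (\big[Num.min/1]_i del i).
  by apply: lt_bigmin => [|i _]; [exact: ltr01|exact: (Hdel i).1].
move=> z zdel; apply: sqnorm_taylor_le => // t; rewrite in_itv/= => /andP[t0 t1].
under eq_fun do rewrite -dotBr.
rewrite (le_trans (sqnorm_dot_le _ _))//.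
  move=> i; under eq_fun do rewrite !mxE.
  by apply: square_integrableB => //; exact: (square_integrable_shift _ (sG i)).
rewrite mulrC ler_wpM2r ?dot_ge0//.
apply: (@le_trans _ _ (\sum_(i < n) kappa / n.+1%:R)).
  apply: ler_sum => i _; under eq_fun do rewrite !mxE.
  apply: (Hdel i).2; rewrite normrZ (le_trans _ (le_trans zdel (bigmin_le _ _
    _)))//.
  by rewrite ler_piMl// gtr0_norm// ltW.
rewrite sumr_const card_ord -[leLHS]mulr_natl mulrCA ler_piMr ?(ltW k0)//.
by rewrite ler_pdivrMr// mul1r ler_nat.
Qed.

Lemma sqnorm_increment_small (eta : R) : 0 < eta -> exists2 del, 0 < del &
  forall z, enorm z < del -> `|D z - A z| <= eta * dot z z.
Proof.
move=> e0; pose S := \sum_i sqnorm leb (fun x => G x 0 i).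
have S0 : 0 <= S by apply: sumr_ge0 => i _; exact: sqnorm_ge0.
(* As A z <= S dot z z, this weight makes t A z at most half of eta dot z z; the tolerance in [k0],
   multiplied by 1 + 1/t, gives the other half. *)
pose t := eta / (2 * (S + 1)).
have t0 : 0 < t by rewrite divr_gt0// mulr_gt0// ltr_wpDl.
have c0 : 0 < 1 + t^-1 by rewrite ltr_wpDl// invr_gt0.
have k0 : 0 < eta / 2 / (1 + t^-1) by rewrite !divr_gt0.
have [del d0 Hd] := sqnorm_taylor_small k0; exists del => // z zd.
have {}Hd := Hd z (le_trans (norm_le_enorm z) (ltW zd)).
have sb := square_integrable_dot sG z.
have suz := square_integrableB (square_integrable_shift z su) su.
have := sqnormD_sub_le t0 sb (square_integrableB suz sb).
rewrite (_ : (fun x => _ + _) = (fun x => u (x + z) - u x)); last first.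
  by apply/funext => x; ring.
move=> /le_trans; apply.
have HA : A z <= dot z z * S by exact: sqnorm_dot_le.
have q0 := dot_ge0 z.
have H1 : t * A z <= eta / 2 * dot z z.
  rewrite (le_trans (ler_wpM2l (ltW t0) HA))// mulrCA mulrC ler_wpM2r//.
  rewrite /t mulrAC ler_pdivrMr ?mulr_gt0 ?ltr_wpDl//; nra.
have H2 := ler_wpM2l (ltW c0) Hd.
have E2 : (1 + t^-1) * (eta / 2 / (1 + t^-1) * dot z z) = eta / 2 * dot z z.
  by rewrite mulrA [(1 + _) * _]mulrC divfK// gt_eqF.
rewrite E2 in H2; rewrite -/(A z); lra.
Qed.

End small_increments.

(** * Positive semidefinite matrices as sums of squares *)

Section psd.
Context {R : rcfType} {n : nat}.
Implicit Types (a : 'I_n -> 'I_n -> R) (x : 'I_n -> R).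

Let quad a x := \sum_i \sum_j a i j * (x i * x j).

Let quad_shift a x k t : (forall i j, a i j = a j i) ->
  quad a (fun i => x i + (i == k)%:R * t) =
  quad a x + 2 * t * (\sum_j a k j * x j) + t ^+ 2 * a k k.
Proof.
move=> sa.
have sel (F : 'I_n -> R) : \sum_i (i == k)%:R * F i = F k.
  rewrite (bigD1 k)//= eqxx mul1r big1 ?addr0// => i /negbTE ->.
  by rewrite mul0r.
transitivity (quad a x + \sum_i (i == k)%:R * (t * \sum_j a i j * x j) +
    \sum_i x i * t * (\sum_j (j == k)%:R * a i j) +
    \sum_i (i == k)%:R * (t ^+ 2 * \sum_j (j == k)%:R * a i j)).
  rewrite /quad -!big_split/=; apply: eq_bigr => i _.
  rewrite !mulr_sumr -!big_split/=; apply: eq_bigr => j _; ring.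
rewrite !sel; congr (_ + _ ).
under [X in _ + _ + X]eq_bigr do rewrite sel.
rewrite -addrA; congr (_ + _).
rewrite [in RHS]mulr_sumr mulr_sumr -big_split/=; apply: eq_bigr => i _.
rewrite (sa i k); ring.
Qed.

(* Cholesky: the row of the first nonzero diagonal entry is eliminated by
   subtracting the square of a linear form. *)
Lemma psd_sum_squares a : (forall i j, a i j = a j i) ->
  (forall x, 0 <= \sum_i \sum_j a i j * (x i * x j)) ->
  exists s : seq ('I_n -> R), forall i j, a i j = \sum_(v <- s) v i * v j.
Proof.
move=> sa pa.
(* Induction on the number k of leading rows that may be nonzero. *)
suff main k : forall a, (forall i j, a i j = a j i) -> (forall x, 0 <= quad a x) ->
    (forall i j : 'I_n, (k <= i)%N -> a i j = 0) ->
    exists s : seq ('I_n -> R), forall i j, a i j = \sum_(v <- s) v i * v j.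
  by apply: (main n) => // i j; rewrite leqNgt ltn_ord.
move=> {sa pa}; elim: k => [|k IH] {}a sa pa a0.
  by exists [::] => i j; rewrite big_nil a0.
have [nk|kn] := leqP n k.
  by apply: IH => // i j ki; have := leq_trans nk ki; rewrite leqNgt ltn_ord.
pose i0 : 'I_n := Ordinal kn.
have q0 t : quad a (fun i => 0 + (i == i0)%:R * t) = t ^+ 2 * a i0 i0.
  rewrite quad_shift//.
  rewrite [X in _ + _ * X + _]big1 ?mulr0 ?addr0; last by move=> j _; rewrite mulr0.
  by rewrite /quad big1 ?add0r// => i _; rewrite big1// => j _; rewrite !mulr0.
have d0 : 0 <= a i0 i0 by have := pa (fun i => 0 + (i == i0)%:R * 1);
    rewrite q0 expr1n mul1r.
have ge_k (i : 'I_n) : (k <= i)%N -> i = i0 \/ (k < i)%N.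
  by rewrite leq_eqVlt => /predU1P[ki|]; [left; exact/val_inj|right].
(* If the diagonal entry is 0, the form is affine in t along e_j + t e_i0, so positivity forces its
   slope, twice a i0 j, to vanish: otherwise the value of t used below makes the form equal to
   -1. *)
have [dE|dN] := eqVneq (a i0 i0) 0.
  apply: IH => // i j /ge_k[->|]; last exact: a0.
  pose x l := 0 + (l == j)%:R * 1 : R.
  have xE : \sum_l a i0 l * x l = a i0 j.
    rewrite (bigD1 j)//= big1 ?addr0 => [|l /negbTE lj];
      last by rewrite /x lj mul0r addr0 mulr0.
    by rewrite /x eqxx mulr1 add0r mulr1.
  have H t : 0 <= quad a x + 2 * t * a i0 j.
    have := pa (fun i => x i + (i == i0)%:R * t).
    by rewrite quad_shift// dE mulr0 addr0 xE.
  apply/eqP; apply: contraT => b0.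
  have := H (- (quad a x + 1) / (2 * a i0 j)).
  rewrite [X in _ + X](_ : _ = - (quad a x + 1)); last by field.
  by rewrite opprD addrA subrr add0r oppr_ge0 ler10.
have dp : 0 < a i0 i0 by rewrite lt_def dN.
have s0 : Num.sqrt (a i0 i0) != 0 by rewrite gt_eqF// sqrtr_gt0.
have ss : Num.sqrt (a i0 i0) ^+ 2 = a i0 i0 by rewrite sqr_sqrtr.
pose v i := a i0 i / Num.sqrt (a i0 i0).
have vv i j : v i * v j = a i0 i * a i0 j / a i0 i0.
  by rewrite -[in RHS]ss /v; field.
(* The Schur complement. Its row [i0] is 0, and it stays positive semidefinite because its form at x
   is that of [a] after changing the coordinate [i0] of x to complete the square. *)
pose a' i j := a i j - v i * v j.
have [||i j ki|s Hs] := IH a'.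
- by move=> i j; rewrite /a' sa mulrC.
- move=> x; pose c := \sum_j a i0 j * x j.
  have -> : quad a' x = quad a (fun i => x i + (i == i0)%:R * (- c / a i0 i0)).
    rewrite quad_shift// -/c.
    have -> : quad a' x = quad a x - c ^+ 2 / a i0 i0; last by field.
    have -> : c ^+ 2 / a i0 i0 = \sum_i \sum_j v i * v j * (x i * x j).
      rewrite expr2 /c big_distrlr/= mulr_suml; apply: eq_bigr => i _.
      by rewrite mulr_suml; apply: eq_bigr => j _; rewrite vv; ring.
    rewrite /quad -sumrB; apply: eq_bigr => i _; rewrite -sumrB.
    by apply: eq_bigr => j _; rewrite /a' mulrBl.
  exact: pa.
- rewrite /a' vv; case: (ge_k i ki) => [->|ki'].
    by rewrite mulrAC divff// mul1r subrr.
  by rewrite a0// (sa i0) a0// !mul0r subrr.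
- exists (v :: s) => i j; rewrite big_cons -Hs /a'; ring.
Qed.
End psd.

(** * Finite sums of Dirac masses on the sphere *)

Section dirac_sum.
Context {R : realType} {n : nat}.
Variable s : seq 'rV[R]_n.

(* The weight v . v cancels the normalization of v, and vanishes when v = 0,
   where v / |v| = 0 is not on the sphere. *)
Definition dirac_sum : set 'rV[R]_n -> \bar R :=
  msum (fun k => mscale (NngNum (dot_ge0 s`_k)) (dirac ((enorm s`_k)^-1 *:
    s`_k) : measure _ R)) (size s).

HB.instance Definition _ := Measure.on dirac_sum.

Lemma dirac_sumE A : dirac_sum A =
  (\sum_(k < size s) (dot s`_k s`_k)%:E * \d_((enorm s`_k)^-1 *: s`_k) A)%E.
Proof. by []. Qed.

Let dirac_sum_fin : fin_num_fun dirac_sum.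
Proof.
move=> A mA; rewrite dirac_sumE; apply/sum_fin_numP => k _ _.
by rewrite fin_numM// diracE.
Qed.

HB.instance Definition _ := Measure_isFinite.Build _ _ _ dirac_sum dirac_sum_fin.

Lemma enorm_eq0 (x : 'rV[R]_n) : enorm x = 0 -> x = 0.
Proof.
move=> x0; apply/rowP => i; rewrite mxE; apply/eqP; rewrite -sqrf_eq0.
by rewrite eq_le sqr_ge0 andbT (le_trans (coord_sqr_le_dot x i))//
  -sqr_enorm x0 expr0n.
Qed.

Lemma unit_sphere_normalize (x : 'rV[R]_n) : x != 0 ->
    unit_sphere n ((enorm x)^-1 *: x).
Proof.
move=> x0; have e0 : enorm x != 0 by apply: contraNN x0 => /eqP/enorm_eq0 ->.
have xx : dot x x = enorm x ^+ 2 by rewrite sqr_enorm.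
rewrite /unit_sphere/= /enorm -/(enorm x) (_ : dot _ _ = 1) ?sqrtr1//.
by rewrite dotZl dotZr xx; field.
Qed.

Lemma dirac_sum_sphere : dirac_sum (~` unit_sphere n) = 0%E.
Proof.
rewrite dirac_sumE big1// => k _; have [->|/unit_sphere_normalize H] := eqVneq
  s`_k 0.
  by rewrite (_ : dot 0 0 = 0) ?mul0e// /dot big1// => i _; rewrite mxE mul0r.
by rewrite diracE memNset ?mule0//=; exact.
Qed.

Lemma integral_dirac_sum (y : 'rV[R]_n) :
  (\int[dirac_sum]_(sigma in unit_sphere n) (`|dot y sigma| ^+ 2)%:E =
   (\sum_(v <- s) dot y v ^+ 2)%:E)%E.
Proof.
have mS := @measurable_unit_sphere R n.
have mf : measurable_fun (unit_sphere n) (fun sigma : 'rV[R]_n =>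
    (`|dot y sigma| ^+ 2)%:E).
  apply/measurable_EFinP; apply: measurable_funTS; apply: measurable_funX.
  by apply: measurableT_comp => //; exact: measurable_dot.
rewrite ge0_integral_measure_sum//.
rewrite (big_nth 0) big_mkord -sumEFin; apply: eq_bigr => k _.
rewrite ge0_integral_mscale//.
rewrite integral_dirac//= diracE.
have [->|s0] := eqVneq s`_k 0.
  rewrite (_ : dot 0 0 = 0); last by rewrite /dot big1// => i _; rewrite mxE mul0r.
  by rewrite mul0e (_ : dot y 0 = 0) ?expr0n// /dot big1// => i _;
    rewrite mxE mulr0.
rewrite mem_set; last exact: unit_sphere_normalize.
have e0 : enorm s`_k != 0 by apply: contraNN s0 => /eqP/enorm_eq0 ->.
rewrite mul1e -EFinM real_normK ?num_real//; congr EFin.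
by rewrite -sqr_enorm dotZr; field.
Qed.

End dirac_sum.

(** * Integrals against a kernel and splitting of the error *)

Section weighted_integrals.
Context {R : realType} {n : nat}.
Implicit Types (w f g : 'rV[R]_n -> R) (z : 'rV[R]_n).
Local Notation leb := (@lebesgue_rV R n).
Local Open Scope ereal_scope.

(** Valued in the extended reals: integrals of nonnegative functions can be added and compared
    before they are known to be finite. *)
Definition kint w f : \bar R := \int[leb]_z (w z * f z)%:E.

Section weight.
Variable w : 'rV[R]_n -> R.
Hypotheses (mw : measurable_fun setT w) (w0 : forall z, (0 <= w z)%R).

Let kfun_ge0 f : (forall z, (0 <= f z)%R) -> forall z, setT z ->
  0 <= (w z * f z)%:E.
Proof. by move=> f0 z _; rewrite lee_fin mulr_ge0. Qed.

Let measurable_kfun f : measurable_fun setT f -> measurable_fun setT (fun z =>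
  (w z * f z)%:E).
Proof. by move=> mf; apply/measurable_EFinP; exact: measurable_funM. Qed.

Lemma kint_ge0 f : (forall z, (0 <= f z)%R) -> 0 <= kint w f.
Proof. by move=> f0; apply: integral_ge0; exact: kfun_ge0. Qed.

Lemma kintD f g : measurable_fun setT f -> measurable_fun setT g ->
  (forall z, (0 <= f z)%R) -> (forall z, (0 <= g z)%R) ->
  kint w (fun z => f z + g z)%R = kint w f + kint w g.
Proof.
move=> mf mg f0 g0; rewrite /kint -ge0_integralD//;
  [|exact: kfun_ge0|exact: measurable_kfun|exact: kfun_ge0|exact: measurable_kfun].
by apply: eq_integral => z _; rewrite mulrDr.
Qed.

Lemma kintZ c f : measurable_fun setT f -> (forall z, (0 <= f z)%R) -> (0 <= c)%R ->
  kint w (fun z => c * f z)%R = c%:E * kint w f.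
Proof.
move=> mf f0 c0; rewrite /kint -ge0_integralZl_EFin//; [|exact: kfun_ge0|exact:
  measurable_kfun].
by apply: eq_integral => z _; rewrite mulrCA.
Qed.

Lemma le_kint f g : measurable_fun setT f -> measurable_fun setT g ->
  (forall z, (0 <= f z)%R) -> (forall z, (f z <= g z)%R) -> kint w f <= kint w g.
Proof.
move=> mf mg f0 fg; apply: ge0_le_integral => //;
  [exact: kfun_ge0|exact: measurable_kfun|exact: measurable_kfun|].
by move=> z _; rewrite lee_fin ler_wpM2l.
Qed.

Lemma kint_indic (A : set 'rV[R]_n) f :
  kint w (fun z => f z * \1_A z)%R = \int[leb]_(z in A) (w z * f z)%:E.
Proof.
rewrite integral_mkcond epatch_indic; apply: eq_integral => z _ /=.
by rewrite -EFinM mulrA.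
Qed.

(* D is the squared norm of the increments of u, and A the squared norm of
   z . grad u, so that D is close to A near 0. The quotients by dot z z vanish
   at z = 0. *)
Lemma kint_error (D A : 'rV[R]_n -> R) (eta C S del r : R) :
  measurable_fun setT D -> measurable_fun setT A ->
  (forall z, (0 <= D z <= C)%R) -> (forall z, (0 <= A z <= S * dot z z)%R) ->
  (0 < del <= 1)%R -> (1 <= r)%R -> (0 <= eta)%R -> (0 <= S)%R ->
  (forall z, enorm z < del -> `|D z - A z| <= eta * dot z z)%R ->
  let d z := (D z / dot z z)%R in
  let a z := (A z / dot z z * \1_(eball 1) z)%R in
  let K := eta%:E * kint w (\1_(eball 1)) +
    (C / del ^+ 2 + S)%:E * kint w (\1_(eball r `\` eball del)) +
    C%:E * kint w (fun z => (dot z z)^-1 * \1_(~` eball r) z)%R in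
  kint w d <= kint w a + K /\ kint w a <= kint w d + K.
Proof.
move=> mD mA D0 A0 /andP[del0 del1] r1 eta0 S0 DA d a K.
have C0 : (0 <= C)%R by have /andP[/le_trans H1 /H1] := D0 0%R.
have CS0 : (0 <= C / del ^+ 2 + S)%R by rewrite addr_ge0// divr_ge0// sqr_ge0.
have mV := @measurable_dotV R n.
have mB s : measurable (@eball R n s) by exact: measurable_eball.
have m1 (E : set 'rV[R]_n) : measurable E -> measurable_fun setT (fun z =>
    \1_E z : R).
  by move=> mE; exact: measurable_indic.
have i0 (E : set 'rV[R]_n) z : (0 <= \1_E z :> R)%R by rewrite indicE.
have q0 z := dot_ge0 z; have V0 (z : 'rV[R]_n) :
    (0 <= (dot z z)^-1)%R by rewrite invr_ge0.
pose e1 (z : 'rV[R]_n) : R := \1_(eball 1) z.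
pose e2 (z : 'rV[R]_n) : R := \1_(eball r `\` eball del) z.
pose e3 (z : 'rV[R]_n) : R := ((dot z z)^-1 * \1_(~` eball r) z)%R.
have me1 : measurable_fun setT e1 by exact: m1.
have me2 : measurable_fun setT e2 by apply: m1; exact: measurableD.
have me3 : measurable_fun setT e3.
  by apply: measurable_funM => //; apply: m1; exact: measurableC.
have e30 z : (0 <= e3 z)%R by rewrite mulr_ge0.
pose err z := (eta * e1 z + (C / del ^+ 2 + S) * e2 z + C * e3 z)%R.
have merr : measurable_fun setT err.
  by apply: measurable_funD; [apply: measurable_funD|]; exact: measurable_funM.
have err0 z : (0 <= err z)%R by rewrite !addr_ge0// mulr_ge0.
have -> : K = kint w err.
  rewrite /err kintD//; [|by apply: measurable_funD; exact:
    measurable_funM|exact: measurable_funM|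
    by move=> z; rewrite addr_ge0// mulr_ge0|by move=> z; rewrite mulr_ge0].
  by rewrite kintD ?kintZ//; [exact: measurable_funM|exact: measurable_funM|
    move=> z; rewrite mulr_ge0|move=> z; rewrite mulr_ge0].
have md : measurable_fun setT d by exact: measurable_funM.
have ma : measurable_fun setT a by apply: measurable_funM => //; exact:
    measurable_funM.
have d0 z : (0 <= d z)%R by rewrite divr_ge0//; case/andP: (D0 z).
have a0 z : (0 <= a z)%R by rewrite mulr_ge0// divr_ge0//; case/andP: (A0 z).
(* Three zones: for |z| < del the expansion holds; for del <= |z| < r, d <= C / del^2 and a <= S;
   for |z| >= r, a = 0 because r >= 1, and d <= C / |z|^2. *)
have de z : (`|d z - a z| <= err z)%R.
  have /andP[Dz0 DC] := D0 z; have /andP[Az0 AS] := A0 z.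
  have ez0 : (0 <= enorm z)%R by exact: sqrtr_ge0.
  have qe := sqr_enorm z.
  have AqS : (A z / dot z z <= S)%R.
    have [->|qN] := eqVneq (dot z z) 0%R; first by rewrite invr0 mulr0.
    by rewrite ler_pdivrMr// lt_def qN q0.
  have Aq0 : (0 <= A z / dot z z)%R by rewrite divr_ge0.
  have [zd|dz] := ltP (enorm z) del.
    have z1 : (enorm z < 1)%R by exact: lt_le_trans zd del1.
    rewrite /d /a /err /e1 !indicE mem_set// mulr1 -mulrBl normrM normfV
      (ger0_norm (q0 z)).
    rewrite (@le_trans _ _ eta)//.
      have [->|qN] := eqVneq (dot z z) 0%R; first by rewrite invr0 mulr0.
      by rewrite ler_pdivrMr ?DA// lt_def qN q0.
    by rewrite mulr1 -addrA lerDl addr_ge0// mulr_ge0// /e2 indicE.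
  have qp : (del ^+ 2 <= dot z z)%R by rewrite -qe lerXn2r ?nnegrE// ltW.
  have q1 : (0 < dot z z)%R by apply: lt_le_trans qp; rewrite exprn_gt0.
  have [zr|rz] := ltP (enorm z) r.
    have e2z : e2 z = 1%R.
      by rewrite /e2 indicE mem_set//; split => //=; apply/negP; rewrite -leNgt.
    rewrite /err e2z mulr1 (@le_trans _ _ (C / del ^+ 2 + S)%R)//; last first.
      by rewrite addrAC lerDr addr_ge0// mulr_ge0.
    have dC : (d z <= C / del ^+ 2)%R.
      by rewrite /d ler_pM// lef_pV2// posrE exprn_gt0.
    have aS : (a z <= S)%R.
      by rewrite /a (le_trans _ AqS)// ler_piMr// indicE; case: (_ \in _).
    have := d0 z; have := a0 z; rewrite ler_norml; lra.
  have e3z : e3 z = (dot z z)^-1%R.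
    by rewrite /e3 indicE mem_set ?mulr1//= /eball/=; apply/negP; rewrite -leNgt.
  have az : a z = 0%R.
    by rewrite /a indicE memNset ?mulr0//= /eball/=; apply/negP;
      rewrite -leNgt (le_trans r1).
  rewrite az subr0 ger0_norm// /err e3z /d.
  rewrite (@le_trans _ _ (C / dot z z)%R)//; first by rewrite ler_wpM2r.
  by rewrite lerDr addr_ge0// mulr_ge0// /e2 indicE.
by split; rewrite -kintD//; apply: le_kint => //; (try by apply:
  measurable_funD) => z;
  have := de z; rewrite ler_norml; lra.
Qed.

End weight.
End weighted_integrals.

(** * Extraction of sequences and limits in the extended reals *)

Section limits.
Context {R : realType}.

Lemma limf_esup_near (F : set_system R) {FF : Filter F} (f : R -> \bar R) (M c :
    R) :
  (limf_esup f F <= M%:E)%E -> M < c -> \forall e \near F, (f e <= c%:E)%E.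
Proof.
move=> fM Mc; have : (limf_esup f F < c%:E)%E by apply: le_lt_trans fM _;
  rewrite lte_fin.
rewrite limf_esupE => /ereal_inf_lt[_ [V FV <-]] Vc.
apply: filterS FV => e Ve; apply: le_trans (ltW Vc).
by apply: ereal_sup_ubound; exists e.
Qed.

(** Closed balls are compact, so the image of the right neighbourhoods of 0 under [m] has a cluster
    point, which a sequence reaches. *)
Lemma right_limit_point k (m : R -> 'rV[R]_k) (C : R) :
  (\forall e \near 0^'+, `|m e| <= C) ->
  exists (eps : nat -> R) (p : 'rV[R]_k), [/\ forall i, eps i \in `]0, 1[,
    eps i @[i --> \oo] --> 0^'+ & m (eps i) @[i --> \oo] --> p].
Proof.
move=> mC.
have [p [_ clp]] := @compact_norm_le R k C (m e @[e --> 0^'+]) _ mC.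
(* The bound 1 / (i + 2) is below 1 even at i = 0, which keeps [eps i] in ]0, 1[. *)
have /choice[eps Heps] (i : nat) : exists e : R, [/\ 0 < e, e < i.+2%:R^-1 &
    `|p - m e| < i.+1%:R^-1].
  have [||_ [[e /andP[e0 ei] <-] pe]] := clp (m @` [set e | 0 < e < i.+2%:R^-1])
      (ball p i.+1%:R^-1).
  - rewrite /nbhs/=; near=> e; exists e => //=.
    by apply/andP; split; near: e; [exact: nbhs_right_gt|apply: nbhs_right_lt;
      rewrite invr_gt0].
  - by apply: nbhsx_ballx; rewrite invr_gt0.
  - by exists e; split=> //; rewrite -ball_normE in pe.
have eps0 i : 0 < eps i by have [] := Heps i.
exists eps, p; split.
- move=> i; rewrite in_itv/= eps0/=; have [_ /lt_trans-> //] := Heps i.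
  by rewrite invf_lt1// ltr1n.
- move=> P [d /= d0 Pd].
  have [j _ Hj] := near_infty_natSinv_lt (PosNum d0).
  exists j => // i /Hj/= ij; apply: Pd => //=; rewrite sub0r normrN gtr0_norm//.
  have [_ /lt_trans-> //] := Heps i.
  by apply: le_lt_trans ij; rewrite lef_pV2 ?posrE// ler_nat.
- apply/cvgrPdist_lt => e e0.
  have [j _ Hj] := near_infty_natSinv_lt (PosNum e0).
  by exists j => // i /Hj/= ij; have [_ _ /lt_trans->] := Heps i.
Unshelve. all: by end_near. Qed.

(** Closeness is stated by sums rather than by a distance because [X k] may be infinite; the case c
    = 1 gives finiteness for large k. *)
Lemma cvg_EFin_close (X : nat -> \bar R) (y : nat -> R) (L : R) :
  y k @[k --> \oo] --> L ->
  (forall c : R, 0 < c -> \forall k \near \oo,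
     (X k <= (y k)%:E + c%:E)%E /\ ((y k)%:E <= X k + c%:E)%E) ->
  X k @[k --> \oo] --> L%:E.
Proof.
move=> yL HX; apply/fine_cvgP; split.
  near=> k; have : (X k <= (y k)%:E + 1%:E)%E /\ ((y k)%:E <= X k + 1%:E)%E.
    by near: k; exact: HX.
  by case: (X k) => [//|[]//|[_]//].
apply/cvgrPdist_le => e e0; have e20 : 0 < e / 2 by rewrite divr_gt0.
near=> k; have : (X k <= (y k)%:E + (e / 2)%:E)%E /\ ((y k)%:E <= X k + (e /
  2)%:E)%E.
  by near: k; exact: HX.
have : `|L - y k| <= e / 2 by near: k; move/cvgrPdist_le : yL; exact.
move=> Ly []; rewrite /=; case: (X k) => [x|//|//].
rewrite /= -!EFinD !lee_fin; move: Ly; rewrite !ler_norml; lra.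
Unshelve. all: by end_near. Qed.

End limits.

(** * Second moments of kernels *)

Section second_moments.
Context {R : realType} {n : nat}.
Implicit Types (w : 'rV[R]_n -> R) (z : 'rV[R]_n).
Local Notation leb := (@lebesgue_rV R n).

Definition moment w i j : R :=
  \int[leb]_z (w z * (z 0 i * z 0 j / dot z z * \1_(eball 1) z)).

Section weight.
Variable w : 'rV[R]_n -> R.
Hypotheses (mw : measurable_fun setT w) (w0 : forall z, 0 <= w z).
Variable M : R.
Hypothesis wM : (kint w (\1_(eball 1)) <= M%:E)%E.

Let iw : rintegrable leb (fun z => w z * \1_(eball 1) z).
Proof.
apply: rintegrableP; last exact: le_lt_trans wM (ltry _).
- by apply: measurable_funM => //; apply: measurable_indic; exact: measurable_eball.
- by move=> z; rewrite mulr_ge0// indicE.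
Qed.

Let moment_dom i j z : `|w z * (z 0 i * z 0 j /
  dot z z * \1_(eball 1) z)| <= w z * \1_(eball 1) z.
Proof.
rewrite normrM (ger0_norm (w0 z)) ler_wpM2l// normrM (@ger0_norm _ (\1__ _))
  ?indicE//.
rewrite ler_piMl// normrM normfV (ger0_norm (dot_ge0 z)) normrM.
have [->|q0] := eqVneq (dot z z) 0; first by rewrite invr0 mulr0.
have qp : 0 < dot z z by rewrite lt_def q0 dot_ge0.
rewrite ler_pdivrMr// mul1r.
have := coord_sqr_le_dot z i; have := coord_sqr_le_dot z j.
rewrite -(real_normK (num_real (z 0 i))) -(real_normK (num_real (z 0 j))).
have := sqr_ge0 (`|z 0 i| - `|z 0 j|); nra.
Qed.

Lemma moment_integrable i j :
  rintegrable leb (fun z => w z * (z 0 i * z 0 j / dot z z * \1_(eball 1) z)).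
Proof.
apply: (le_rintegrable _ (moment_dom i j)) => //.
apply: measurable_funM => //; apply: measurable_funM; last first.
  by apply: measurable_indic; exact: measurable_eball.
apply: measurable_funM; last exact: measurable_dotV.
by apply: measurable_funM; exact: measurable_coord.
Qed.

Lemma moment_le i j : `|moment w i j| <= M.
Proof.
apply: le_trans (le_normr_Rintegral measurableT (moment_integrable i j)) _.
apply: (@le_trans _ _ (\int[leb]_z (w z * \1_(eball 1) z))).
  by apply: le_Rintegral => //; exact: (integrable_norm (moment_integrable i j)).
by rewrite -lee_fin -EFin_rintegral.
Qed.

(** Used with two matrices: the Gram matrix of the components of the gradient, for the energy, and x
    x^T, for the positivity of the limit. *)
Lemma kint_quadratic (c : 'I_n -> 'I_n -> R) :
  kint w (fun z => (\sum_i \sum_j z 0 i * z 0 j * c i j) /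
    dot z z * \1_(eball 1) z) =
  (\sum_i \sum_j c i j * moment w i j)%:E.
Proof.
have i1 i j := moment_integrable i j.
have iz i j : rintegrable leb (fun z => c i j * (w z * (z 0 i * z 0 j /
    dot z z * \1_(eball 1) z))).
  exact: rintegrableZ.
have isum i : rintegrable leb (fun z => \sum_j c i j * (w z * (z 0 i * z 0 j /
    dot z z * \1_(eball 1) z))).
  exact: rintegrable_sum.
transitivity (\int[leb]_z (\sum_i \sum_j c i j * (w z * (z 0 i * z 0 j /
  dot z z * \1_(eball 1) z)))%:E)%E.
  apply: eq_integral => z _; congr EFin.
  rewrite !mulr_suml mulr_sumr; apply: eq_bigr => i _.
  rewrite !mulr_suml mulr_sumr; apply: eq_bigr => j _; ring.
rewrite EFin_rintegral; last exact: rintegrable_sum.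
rewrite Rintegral_sum//; congr EFin; apply: eq_bigr => i _.
rewrite Rintegral_sum//; apply: eq_bigr => j _.
exact: (RintegralZl _ measurableT (i1 i j)).
Qed.

End weight.

Lemma sqnorm_dotE (G : 'rV[R]_n -> 'rV[R]_n) z : (forall i,
    square_integrable leb (fun x => G x 0 i)) ->
  sqnorm leb (fun x => dot z (G x)) =
  \sum_i \sum_j z 0 i * z 0 j * \int[leb]_x (G x 0 i * G x 0 j).
Proof.
move=> sG; have i1 i j := rintegrableM (sG i) (sG j).
have iz i j : rintegrable leb (fun x => (z 0 i * z 0 j) * (G x 0 i * G x 0 j)).
  exact: rintegrableZ.
transitivity (\int[leb]_x (\sum_i \sum_j (z 0 i * z 0 j) * (G x 0 i * G x 0 j))).
  apply: eq_Rintegral => x _; rewrite expr2 /dot big_distrlr/=.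
  by apply: eq_bigr => i _; apply: eq_bigr => j _; ring.
rewrite Rintegral_sum => [|i]; last exact: rintegrable_sum.
apply: eq_bigr => i _; rewrite Rintegral_sum//; apply: eq_bigr => j _.
exact: (RintegralZl _ measurableT (i1 i j)).
Qed.

Lemma measurable_sqnorm_increment (u : 'rV[R]_n -> R) : square_integrable leb u ->
  measurable_fun setT (fun z => sqnorm leb (fun x => u (x + z) - u x)).
Proof.
move=> su; have [mu _] := su.
pose F (p : 'rV[R]_n * 'rV[R]_n) := ((u (p.1 + p.2) - u p.2) ^+ 2)%:E.
have mF : measurable_fun setT F.
  apply/measurable_EFinP; apply: measurable_funX; apply: measurable_funB.
    exact: measurableT_comp mu (@measurable_addp R n).
  exact: measurableT_comp mu _.
have F0 p : (0 <= F p)%E by rewrite lee_fin sqr_ge0.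
have := measurable_fun_fubini_tonelli_F (m2 := leb) _ mF F0.
move=> /(measurableT_comp (@fine_measurable R setT measurableT)).
congr (measurable_fun _ _); apply/funext => z /=.
by congr fine; apply: eq_integral => x _; rewrite /F/= [(z + x)%R]addrC.
Qed.

End second_moments.

Lemma cvg_sumr (R : realType) (T : Type) (F : set_system T) {FF : Filter F}
  (I : Type) (r : seq I) (f : I -> T -> R) (l : I -> R) :
  (forall i, f i x @[x --> F] --> l i) ->
  \sum_(i <- r) f i x @[x --> F] --> \sum_(i <- r) l i.
Proof. by move=> fl; apply: cvg_big => [|i _]; [exact: add_continuous|exact:
  fl]. Qed.

(** * Localization of the energy at the origin *)

Section localization.
Context {R : realType} {n : nat}.
Local Notation leb := (@lebesgue_rV R n).

(** Weak convergence only tests continuous functions. A majorant of the indicator of the annulus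
    that vanishes at 0 has limit 0 against the kernels, and so has the mass of the annulus. *)
Lemma annulus_cutoff (del s : R) : 0 < del -> 0 < s -> exists f : 'rV[R]_n -> R,
  [/\ Cc f, f 0 = 0, forall z, 0 <= f z &
    forall z, del <= enorm z -> enorm z < s -> 1 <= f z].
Proof.
(* On the annulus dot z z >= del^2 and 4 s^2 - dot z z >= 3 s^2, so this c makes the product at
   least 1; beyond radius 2 s the maximum with 0 cuts it off. *)
move=> d0 s0; pose c := (3 * del ^+ 2 * s ^+ 2)^-1.
have c0 : 0 < c by rewrite invr_gt0 !mulr_gt0// exprn_gt0.
pose f (z : 'rV[R]_n) : R := Num.max 0 (c * (dot z z * (4 * s ^+ 2 - dot z z))).
have cdot : continuous (fun z : 'rV[R]_n => dot z z).
  by move=> z; apply: (@cvg_sumr _ _ (nbhs z)) => i; apply: continuousM; exact: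
    coord_continuous.
exists f; split.
- split.
    move=> z; apply: (@continuous_max R _ (fun=> 0)
      (fun z : 'rV[R]_n => c * (dot z z * (4 * s ^+ 2 - dot z z))) z);
        first exact: cst_continuous.
    apply: continuousM; first exact: cst_continuous.
    apply: continuousM; first exact: cdot.
    by apply: continuousB; [exact: cst_continuous|exact: cdot].
  apply: bounded_support_compact; exists (2 * s) => z fz.
  rewrite (le_trans (norm_le_enorm z))// leNgt; apply: contra fz => sz.
  rewrite /f; apply/eqP/max_idPl; rewrite pmulr_rle0// mulr_ge0_le0 ?dot_ge0//
    subr_le0 -sqr_enorm.
  have : (2 * s) ^+ 2 <= enorm z ^+ 2 by rewrite lerXn2r ?nnegrE ?sqrtr_ge0
      ?mulr_ge0 ?ltW.
  by rewrite exprMn; lra.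
- by rewrite /f /dot big1 ?mul0r ?mulr0 ?maxxx// => i _; rewrite mxE mulr0.
- by move=> z; rewrite le_max lexx.
- move=> z dz zs; rewrite le_max; apply/orP; right.
  have q1 : del ^+ 2 <= dot z z by rewrite -sqr_enorm lerXn2r ?nnegrE
      ?sqrtr_ge0// ltW.
  have q2 : dot z z <= s ^+ 2.
    by rewrite -sqr_enorm lerXn2r ?nnegrE ?sqrtr_ge0// ltW.
  rewrite mulrC ler_pdivlMr ?mul1r; last by rewrite !mulr_gt0// exprn_gt0.
  rewrite -mulrA mulrCA ler_pM ?mulr_ge0 ?sqr_ge0//; lra.
Qed.

Variables (w : nat -> 'rV[R]_n -> R) (M : R) (p : 'I_n -> 'I_n -> R).
Hypotheses (mw : forall k, measurable_fun setT (w k)) (w0 : forall k z, 0 <= w k z).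
Hypothesis M0 : 0 < M.
Hypothesis near_mass : \forall k \near \oo, (kint (w k) (\1_(eball 1)) <= M%:E)%E.
Hypothesis far_mass : forall s : R, 0 < s -> \forall k \near \oo,
  ((s ^+ 2)%:E * kint (w k) (fun z => (dot z z)^-1 * \1_(~` eball s) z)%R <=
    M%:E)%E.
Hypothesis annulus_mass : forall del s c : R, 0 < del -> 0 < s -> 0 < c ->
  \forall k \near \oo, (kint (w k) (\1_(eball s `\` eball del)) <= c%:E)%E.
Hypothesis moment_cvg : forall i j, moment (w k) i j @[k --> \oo] --> p i j.

Lemma moment_limit_psd (x : 'I_n -> R) : 0 <= \sum_i \sum_j p i j * (x i * x j).
Proof.
have cvg1 : \sum_i \sum_j (x i * x j) * moment (w k) i j @[k --> \oo] -->
    \sum_i \sum_j (x i * x j) * p i j.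
  by apply: cvg_sumr => i; apply: cvg_sumr => j; apply: cvgM => //; exact: cvg_cst.
under eq_bigr => i _ do under eq_bigr => j _ do rewrite mulrC.
apply: cvgr_to_ge cvg1 _; near=> k.
rewrite -lee_fin -(@kint_quadratic _ _ (w k) (mw k) (w0 k) M) //; last by near: k.
apply: kint_ge0 => // z; rewrite mulr_ge0 ?indicE// divr_ge0 ?dot_ge0//.
rewrite (_ : \sum_i _ = (\sum_i z 0 i * x i) ^+ 2) ?sqr_ge0//.
rewrite expr2 big_distrlr/=; apply: eq_bigr => i _; apply: eq_bigr => j _; ring.
Unshelve. all: by end_near. Qed.

Lemma kint_increment_cvg (u : 'rV[R]_n -> R) (G : 'rV[R]_n -> 'rV[R]_n) :
  square_integrable leb u -> (forall i, square_integrable leb (fun x => G x 0 i)) ->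
  (forall phi, bump phi -> forall i,
    \int[leb]_x (u x * partial i phi x) = - \int[leb]_x (G x 0 i * phi x)) ->
  kint (w k) (fun z => sqnorm leb (fun x => u (x + z) - u x) / dot z z) @[k -->
    \oo] -->
  (\sum_i \sum_j (\int[leb]_x (G x 0 i * G x 0 j)) * p i j)%:E.
Proof.
move=> su sG ibp.
pose D z := sqnorm leb (fun x => u (x + z) - u x).
pose A z := sqnorm leb (fun x => dot z (G x)).
pose c i j := \int[leb]_x (G x 0 i * G x 0 j).
pose S := \sum_i sqnorm leb (fun x => G x 0 i).
pose C := 4 * sqnorm leb u.
have S0 : 0 <= S by apply: sumr_ge0 => i _; exact: sqnorm_ge0.
have C0 : 0 <= C by rewrite mulr_ge0// sqnorm_ge0.
have DC z : 0 <= D z <= C by rewrite sqnorm_ge0 sqnorm_increment_le.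
have AS z : 0 <= A z <= S * dot z z by rewrite sqnorm_ge0 mulrC sqnorm_dot_le.
have mD : measurable_fun setT D by exact: measurable_sqnorm_increment.
have AE z : A z = \sum_i \sum_j z 0 i * z 0 j * c i j by exact: sqnorm_dotE.
have mA : measurable_fun setT A.
  rewrite (funext AE).
  apply: measurable_sum => i; apply: measurable_sum => j.
  by apply: measurable_funM => //; apply: measurable_funM; exact: measurable_coord.
apply: (@cvg_EFin_close _ _ (fun k => \sum_i \sum_j c i j * moment (w k) i j)).
  by apply: cvg_sumr => i; apply: cvg_sumr => j; apply: cvgM => //; exact: cvg_cst.
move=> e e0.
(* Each of the three errors is to be at most e / 3. The first is eta times a mass bounded by M; eta
   determines [del], on which the constant [K2] of the annulus depends, and only then is k taken
   large. *)
have eta0 : 0 < e / (3 * M) by rewrite divr_gt0// mulr_gt0.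
have [del0 del00 Hdel0] := sqnorm_increment_small su sG ibp eta0.
pose del := Num.min 1 del0.
have del_gt0 : 0 < del by rewrite lt_min ltr01.
have del1 : 0 < del <= 1 by rewrite del_gt0 ge_min lexx.
have Hdel z : enorm z < del -> `|D z - A z| <= e / (3 * M) * dot z z.
  by rewrite lt_min => /andP[_]; exact: Hdel0.
(* The far error is at most C M / s^2; s >= 1 and s >= 3 C M / e bring it below e / 3. *)
pose s := 1 + 3 * C * M / e.
have CM0 : 0 <= 3 * C * M by exact: mulr_ge0 (mulr_ge0 (ler0n _ _) C0) (ltW M0).
have s1 : 1 <= s by rewrite lerDl divr_ge0// ltW.
have s0 : 0 < s by exact: lt_le_trans s1.
pose K2 := C / del ^+ 2 + S.
have K20 : 0 <= K2 by rewrite addr_ge0// divr_ge0// sqr_ge0.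
have c20 : 0 < e / (3 * (K2 + 1)) by rewrite divr_gt0// mulr_gt0// ltr_wpDl.
near=> k.
have wk1 : (kint (w k) (\1_(eball 1)) <= M%:E)%E by near: k.
have wk2 : (kint (w k) (\1_(eball s `\` eball del)) <= (e / (3 * (K2 + 1)))%:E)%E.
  by near: k; exact: annulus_mass.
have wk3 : ((s ^+ 2)%:E * kint (w k) (fun z =>
    (dot z z)^-1 * \1_(~` eball s) z)%R <= M%:E)%E.
  by near: k; exact: far_mass.
have := kint_error (mw k) (w0 k) mD mA DC AS del1 s1 (ltW eta0) S0 Hdel.
cbv zeta.
have -> : kint (w k) (fun z => A z / dot z z * \1_(eball 1) z) =
    (\sum_i \sum_j c i j * moment (w k) i j)%:E.
  rewrite -(@kint_quadratic _ _ (w k) (mw k) (w0 k) M wk1 c).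
  by congr kint; apply/funext => z; rewrite AE.
set K := (_ + _ + _)%E.
suff Ke : (K <= e%:E)%E.
  move=> [H1 H2]; split; first by rewrite (le_trans H1)// leeD2l.
  by rewrite (le_trans H2)// leeD2l.
have wk30 : (0 <= kint (w k) (fun z => (dot z z)^-1 * \1_(~` eball s) z)%R)%E.
  by apply: kint_ge0 => // z; rewrite mulr_ge0 ?indicE// invr_ge0 dot_ge0.
rewrite (_ : e%:E = (e / 3)%:E + (e / 3)%:E + (e / 3)%:E)%E; last first.
  by rewrite -!EFinD; congr EFin; field.
apply: leeD; first apply: leeD.
- apply: (@le_trans _ _ ((e / (3 * M))%:E * M%:E)%E).
    by rewrite lee_wpmul2l// lee_fin ltW.
  by rewrite -EFinM lee_fin le_eqVlt; apply/orP; left; apply/eqP; field;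
    rewrite gt_eqF.
- apply: (@le_trans _ _ (K2%:E * (e / (3 * (K2 + 1)))%:E)%E).
    by rewrite lee_wpmul2l// lee_fin.
  rewrite -EFinM lee_fin ler_pdivlMr// mulrA mulrAC ler_pdivrMr ?mulr_gt0
    ?ltr_wpDl//; nra.
- move: wk3 wk30; case: (kint _ _) => [y| |//].
    rewrite -!EFinM !lee_fin => ys y0.
    have sC : 3 * C * M <= e * s.
      by rewrite /s mulrDr mulr1 [e * (_ / e)]mulrC divfK ?gt_eqF// lerDr ltW.
    have ss : s * y <= s ^+ 2 * y by rewrite ler_wpM2r// expr2 ler_peMl// ltW.
    have C3 : 0 <= 3 * C by exact: mulr_ge0 (ler0n _ _) C0.
    have H := le_trans (ler_wpM2l C3 (le_trans ss ys)) sC.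
    rewrite ler_pdivlMr// -(ler_pM2r s0); nra.
  by rewrite gt0_muley ?lte_fin ?exprn_gt0.
Unshelve. all: by end_near. Qed.

End localization.

(** * Borel kernels and the limit of the energies *)

Section kernels.
Context {R : realType} {n : nat}.
Local Notation leb := (@lebesgue_rV R n).

Lemma borel_kernels (rho : R -> 'rV[R]_n -> R) :
  (forall e, e \in `]0, 1[ -> lebesgue_measurable (rho e)) ->
  (forall e, e \in `]0, 1[ -> forall z, 0 <= rho e z) ->
  exists (r : R -> 'rV[R]_n -> R) (Y : R -> set 'rV[R]_n),
    [/\ forall e, measurable_fun setT (r e), forall e z, 0 <= r e z, forall e,
      null_set (Y e) &
      forall e, e \in `]0, 1[ -> forall z, ~ Y e z -> rho e z = r e z].
Proof.
move=> mrho rho0.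
have /choice[rY HrY] e : exists rY : ('rV[R]_n -> R) * set 'rV[R]_n,
    [/\ measurable_fun setT rY.1, forall z, 0 <= rY.1 z, null_set rY.2 &
      e \in `]0, 1[ -> forall z, ~ rY.2 z -> rho e z = rY.1 z].
  have [eI|eI] := boolP (e \in `]0, 1[); last first.
    (* The zero kernel is the default value for parameters outside ]0, 1[. *)
    exists (fun=> 0, set0); split => [||/=|//]; [exact: measurable_cst|by []|].
    by split; [exact: measurable0|exact: measure0].
  have [Z [mZ Z0 mrZ]] := lebesgue_measurable_borel (mrho e eI).
  exists (rho e \_ (~` Z), Z); split => //=.
    by move=> z; rewrite patchE; case: ifP => // _; exact: rho0.
  by move=> _ z Zz; exact: restrict_off.
by exists (fun e => (rY e).1), (fun e => (rY e).2); split=> [e|e|e|e]; case: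
  (HrY e).
Qed.

Lemma kint_off_null (w w' f : 'rV[R]_n -> R) (Y : set 'rV[R]_n) : null_set Y ->
  (forall z, ~ Y z -> w z = w' z) -> kint w f = kint w' f.
Proof.
move=> [mY Y0] ww; apply: (eq_integral_off_null mY Y0) => z Yz.
by rewrite ww.
Qed.

End kernels.

Theorem corollary1p3 (R : realType) (N : nat) (rho : R -> 'rV[R]_N -> R)
    (M alpha : R)
  (hN : (1 <= N)%N)
  (rho_meas : forall e : R, e \in `]0, 1[ -> lebesgue_measurable (rho e))
  (rho_ge0 : forall e : R, e \in `]0, 1[ -> forall z, 0 <= rho e z)
  (M_ge0 : 0 <= M)
  (rho_bound : forall r : R, 0 < r ->
    (limf_esup (fun e : R =>
        \int[lebesgue_rV N]_(z in eball r) (rho e z)%:E +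
        (r ^+ 2)%:E * \int[lebesgue_rV N]_(z in ~` eball r)
                       (rho e z / enorm z ^+ 2)%:E) 0^'+ <= M%:E)%E)
  (alpha_ge0 : 0 <= alpha)
  (rho_cvg : forall f : 'rV[R]_N -> R, Cc f ->
    (\int[lebesgue_rV N]_z (rho e z * f z)%:E @[e --> 0^'+] -->
     alpha%:E * \int[\d_(0%R : 'rV[R]_N)]_z (f z)%:E)%E) :
  exists (eps : nat -> R) (mu : {finite_measure set 'rV[R]_N -> \bar R}),
    [/\ forall k, eps k \in `]0, 1[,
        eps k @[k --> \oo] --> 0,
        mu (~` unit_sphere N) = 0%E &
        forall (u : 'rV[R]_N -> R) (Du : 'rV[R]_N -> 'rV[R]_N),
          H1 u -> weak_gradient u Du ->
          (nonlocal_energy (rho (eps k)) u @[k --> \oo] -->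
           (2^-1)%:E * \int[lebesgue_rV N]_x \int[mu]_(sigma in unit_sphere N)
                         (`|dot (Du x) sigma| ^+ 2)%:E)%E].
Proof.
have [r [Y [mr r0 nY rr]]] := borel_kernels rho_meas rho_ge0.
have near01 : \forall e \near 0^'+, e \in `](0 : R), 1[.
  near=> e; rewrite in_itv/=; apply/andP; split; near: e; first exact:
    nbhs_right_gt.
  exact: nbhs_right_lt.
(* A limsup at most M only gives eventual bounds by constants larger than M; M + 1 is moreover
   positive, so that it can be divided by. *)
have M1 : M < M + 1 by rewrite ltrDl.
have mB s : measurable (@eball R N s) by exact: measurable_eball.
have bound (s : R) : 0 < s -> \forall e \near 0^'+,
    (kint (r e) (\1_(eball s)) <= (M + 1)%:E)%E /\
    ((s ^+ 2)%:E * kint (r e) (fun z => (dot z z)^-1 * \1_(~` eball s) z)%R <=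
      (M + 1)%:E)%E.
  move=> s0; apply: filterS2 near01 (limf_esup_near (rho_bound s s0) M1) => e eI.
  have -> : (\int[lebesgue_rV N]_(z in eball s) (rho e z)%:E = kint (r e)
      (\1_(eball s)))%E.
    rewrite -(kint_off_null _ (nY e) (rr e eI)).
    transitivity (kint (rho e) (fun z => 1 * \1_(eball s) z));
      last by congr kint; apply/funext => z; rewrite mul1r.
    by rewrite kint_indic; apply: eq_integral => z _; rewrite mulr1.
  have -> : (\int[lebesgue_rV N]_(z in ~` eball s) (rho e z / enorm z ^+ 2)%:E =
      kint (r e) (fun z => (dot z z)^-1 * \1_(~` eball s) z)%R)%E.
    rewrite -(kint_off_null _ (nY e) (rr e eI)) kint_indic.
    by apply: eq_integral => z _; rewrite sqr_enorm.
  have k1 : (0 <= kint (r e) (\1_(eball s)))%E by apply: kint_ge0 => // z;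
      rewrite indicE.
  have k2 : (0 <= (s ^+ 2)%:E * kint (r e) (fun z =>
      (dot z z)^-1 * \1_(~` eball s) z)%R)%E.
    rewrite mule_ge0 ?lee_fin ?sqr_ge0//; apply: kint_ge0 => // z.
    by rewrite mulr_ge0 ?indicE// invr_ge0 dot_ge0.
  by move=> H; split; apply: le_trans H; [rewrite leeDl|rewrite leeDr].
(* The cutoff f dominates the indicator of the annulus, and its integrals against the kernels tend
   to alpha f(0) = 0. *)
have annulus (del s c : R) : 0 < del -> 0 < s -> 0 < c ->
    \forall e \near 0^'+, (kint (r e) (\1_(eball s `\` eball del)) <= c%:E)%E.
  move=> d0 s0 c0; have [f [Cf f0 fge0 f1]] := @annulus_cutoff R N _ _ d0 s0.
  have mf : measurable_fun setT f by apply: continuous_measurable_rV; case: Cf.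
  have := rho_cvg f Cf.
  rewrite integral_dirac//=; last exact/measurable_EFinP.
  rewrite f0 mule0 mule0 => /fine_cvgP[ffin /cvgr0Pnorm_le/(_ c c0) fc].
  near=> e; have eI : e \in `](0 : R), 1[ by near: e.
  have mA : measurable (@eball R N s `\` eball del) by exact: measurableD.
  apply: (@le_trans _ _ (kint (r e) f)).
    apply: le_kint; [exact: mr|exact: r0|exact: measurable_indic|exact: mf| |] => z.
      by rewrite indicE.
    rewrite indicE; case: (boolP (z \in _)) => //; rewrite inE => -[zs zd].
    by apply: f1 => //; rewrite leNgt; apply/negP.
  rewrite -(kint_off_null _ (nY e) (rr e eI)) -[kint _ _]fineK; last by near: e.
  rewrite lee_fin (le_trans (ler_norm _))//; near: e; exact: fc.
(* All the moments form one row vector, so that a single extraction makes them converge together,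
   before any [u] is given. *)
pose m e := mxvec (\matrix_(i, j) moment (r e) i j).
have mE e i j : m e 0 (mxvec_index i j) = moment (r e) i j by rewrite mxvecE mxE.
have mbound : \forall e \near 0^'+, `|m e| <= M + 1.
  apply: filterS (bound 1 ltr01) => e [H _].
  apply: norm_le_coord => [|k]; first by rewrite addr_ge0.
  by case/mxvec_indexP: k => i j; rewrite mE moment_le.
have [eps [P [epsI eps0 mP]]] := right_limit_point mbound.
pose p i j : R := P 0 (mxvec_index i j).
have mp i j : moment (r (eps k)) i j @[k --> \oo] --> p i j.
  under eq_fun do rewrite -mE.
  apply: (cvg_comp (fun k => m (eps k)) (fun x : 'rV[R]_(N * N) =>
    x 0 (mxvec_index i j)) mP).
  exact: coord_continuous.
have transport (Q : R -> Prop) : (\forall e \near 0^'+, Q e) ->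
    \forall k \near \oo, Q (eps k).
  by move=> HQ; exact: (eps0 _ HQ).
have M10 : 0 < M + 1 by rewrite ltr_wpDl.
have near1 : \forall k \near \oo, (kint (r (eps k)) (\1_(eball 1)) <= (M + 1)%:E)%E.
  by apply: filterS (transport _ (bound 1 ltr01)) => k [].
have near2 (s : R) : 0 < s -> \forall k \near \oo, ((s ^+ 2)%:E *
    kint (r (eps k)) (fun z => (dot z z)^-1 * \1_(~` eball s) z)%R <= (M + 1)%:E)%E.
  by move=> s0; apply: filterS (transport _ (bound s s0)) => k [].
have near3 (del s c : R) : 0 < del -> 0 < s -> 0 < c ->
    \forall k \near \oo, (kint (r (eps k)) (\1_(eball s `\` eball del)) <= c%:E)%E.
  by move=> d0 s0 c0; exact: transport (annulus del s c d0 s0 c0).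
have psym i j : p i j = p j i.
  have E : (fun k => moment (r (eps k)) i j) = (fun k => moment (r (eps k)) j i).
    apply/funext => k; apply: eq_Rintegral => z _.
    by congr (_ * (_ * _ * _)); exact: mulrC.
  have := mp i j; rewrite E => /(cvg_lim (@Rhausdorff R)) <-.
  exact: (cvg_lim (@Rhausdorff R) (mp j i)).
have ppsd := moment_limit_psd (fun k => mr (eps k)) (fun k => r0 (eps k)) near1 mp.
have [s Hs] := psd_sum_squares psym ppsd.
pose sv : seq 'rV[R]_N := map (fun v => \row_i v i) s.
exists eps, (dirac_sum sv); split => //.
  by apply: cvg_trans eps0 _; exact: cvg_within.
  exact: dirac_sum_sphere.
move=> u Du Hu wDu.
have [Z [u' [G [nZ su sG ibp uG]]]] := H1_borel Hu wDu.
under eq_fun => k do rewrite (nonlocal_energyE (nY (eps k)) nZ (rr _ (epsI k))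
  (fun z Zz => (uG z Zz).1) (r0 _) (mr _) su).
apply: cvgeZl => //.
(* The sum over v of (v . G)^2 integrates to the sum over i, j of a_ij times the sum over v of v_i
   v_j, which is [p i j] by the choice of [s]. *)
have -> : (\int[lebesgue_rV N]_x \int[dirac_sum sv]_(sigma in unit_sphere N)
    (`|dot (Du x) sigma| ^+ 2)%:E =
    (\sum_i \sum_j (\int[lebesgue_rV N]_x (G x 0 i * G x 0 j)) * p i j)%:E)%E.
  have sd v : rintegrable (lebesgue_rV N) (fun x => dot v (G x) ^+ 2).
    by case: (square_integrable_dot sG v).
  transitivity (\int[lebesgue_rV N]_x (\sum_(v <- sv) dot v (G x) ^+ 2)%:E)%E.
    apply: (eq_integral_off_null nZ.1 nZ.2) => x Zx; rewrite integral_dirac_sum.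
    by congr EFin; apply: eq_bigr => v _; rewrite (uG x Zx).2 /dot;
      under eq_bigr do rewrite mulrC.
  rewrite EFin_rintegral; last exact: rintegrable_sum.
  rewrite Rintegral_sum// big_map; congr EFin.
  under eq_bigr => v _ do rewrite -/(sqnorm _ _) sqnorm_dotE//.
  rewrite exchange_big; apply: eq_bigr => i _; rewrite exchange_big; apply:
    eq_bigr => j _.
  rewrite /= Hs mulr_sumr; apply: eq_bigr => v _; by rewrite !mxE mulrC.
rewrite [X in X @ _ --> _](_ : _ = fun k => kint (r (eps k)) (fun z =>
  sqnorm (lebesgue_rV N) (fun x => u' (x + z) - u' x) / dot z z)).
  exact: (kint_increment_cvg (fun k => mr (eps k)) (fun k =>
    r0 (eps k)) M10 near1 near2 near3 mp su sG ibp).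
by apply/funext => k; apply: eq_integral => z _; rewrite sqr_enorm.
Unshelve. all: by end_near. Qed.
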